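(* Assume (Z). For each $x\in\mathcal I$, $\operatorname{argmin}_{h\in\mathcal H}V(x,h)\subseteq(P'(a),P'(b))$ (the interior of $\mathcal H$), and every minimiser $h^*\in\operatorname{argmin}_{h\in\mathcal H}V(x,h)$ satisfies $h^*=\widehat\Gamma_{h^*}(x)$.
   Context: Let $(\Omega,\mathcal F,\mathsf P)$ carry a standard Brownian motion $W$ with natural filtration $\mathbb F$ satisfying the usual conditions. Fix $r>0$, $\sigma>0$, $K>0$. For $x>0$ let $S^x$ solve $\mathrm dS_t=rS_t\,\mathrm dt+\sigma S_t\,\mathrm dW_t$, $S_0=x$; $\mathsf E_x$ denotes expectation when $S_0=x$. Put $d=2r/\sigma^2$, $\hat a=K/(1+1/d)$, $P(x)=\frac1d\hat a^{1+d}x^{-d}$ for $x\ge\hat a$ and $P(x)=K-x$ for $0\le x\le\hat a$, so $P'(x)=\max\{-(\hat a/x)^{1+d},-1\}$. Fix $\hat a\le a<b<\infty$, $\mathcal I=(a,b)$, $\tau^x_{\mathcal I}=\inf\{t\ge0:S^x_t\notin\mathcal I\}$ (written $\tau_{\mathcal I}$ under $\mathsf E_x$), $\mathcal T_x$ the set of $\mathbb F$-stopping times $\tau\le\tau^x_{\mathcal I}$ a.s., $\mathcal H=[P'(a),P'(b)]$, $f(x,\theta)=(\theta-P'(x))^2\sigma^2x^2$. For $x\in[a,b]$ let $\gamma_1(x)=\mathsf E_x[\int_0^{\tau_{\mathcal I}}e^{-2ru}\sigma^2S_u^2\,\mathrm du]$, $\gamma_2(x)=\mathsf E_x[\int_0^{\tau_{\mathcal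 I}}e^{-2ru}P'(S_u)\sigma^2S_u^2\,\mathrm du]$, $\gamma_3(x)=\mathsf E_x[\int_0^{\tau_{\mathcal I}}e^{-2ru}(P'(S_u))^2\sigma^2S_u^2\,\mathrm du]$; for $x\in\mathcal I$ set $M(x)=\gamma_3(x)-\gamma_2(x)^2/\gamma_1(x)$, and set $M(a)=M(b)=0$. For $(x,h)\in[a,b]\times\mathcal H$ define $V(x,h)=\inf_{\tau\in\mathcal T_x}\mathsf E_x\big[\int_0^\tau e^{-2ru}f(S_u,h)\,\mathrm du+e^{-2r\tau}M(S_\tau)\big]$ (this is the minimal variance of the discounted hedging error when the initial stock holding is $h$ and one optimal rebalancing is allowed before $\tau_{\mathcal I}$), $\mathcal C_h=\{x\in[a,b]:V(x,h)<M(x)\}$, $\mathcal D_h=\{x\in[a,b]:V(x,h)=M(x)\}$, and $\tau^*_{x,h}=\inf\{t\ge0:S^x_t\in\mathcal D_h\}$ (written $\tau^*_h$ under $\mathsf E_x$). Let $\mathcal Lv(x)=\frac{\sigma^2}{2}x^2v''(x)+rxv'(x)$ and $G(x,h)=(\mathcal L-2r)M(x)+f(x,h)$ for $x\in\mathcal I$. Assumption (Z): for each $h\in\mathcal H$, the equation $G(x,h)=0$ has at most two roots $x\in\mathcal I$. Under (Z), for each $h\in\mathcal H$ the set $\mathcal C_h$ is an open interval $(x^*_{1,h},x^*_{2,h})$ with $a\le x^*_{1,h}<x^*_{2,h}\le b$. For $h\in\mathcal H$ and $x\in[a,b]$ let $\hat\gamma_{h,1}(x)=\mathsf E_x[\int_0^{\tau^*_h}e^{-2ru}\sigma^2S_u^2\,\mathrm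 du]$, $\hat\gamma_{h,2}(x)=\mathsf E_x[\int_0^{\tau^*_h}e^{-2ru}P'(S_u)\sigma^2S_u^2\,\mathrm du]$, and for $x\in(x^*_{1,h},x^*_{2,h})$ let $\widehat\Gamma_h(x)=\hat\gamma_{h,2}(x)/\hat\gamma_{h,1}(x)$. *)

(* Defs.v *)
From HB Require Import structures.
From mathcomp Require Import all_boot all_order all_algebra.
From mathcomp Require Import all_classical all_reals all_analysis.
Set Implicit Arguments. Unset Strict Implicit. Unset Printing Implicit Defensive.
Import Order.TTheory GRing.Theory Num.Theory.
Import numFieldNormedType.Exports.
Local Open Scope classical_set_scope.
Local Open Scope ring_scope.

Section Model.
Context {R : realType} {d : measure_display} {T : measurableType d}.
Variable (P : probability T R) (W : R -> T -> R).
Variables (r sig K a b : R).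

Definition raw_gen (u : R) : set (set T) :=
  [set A | exists s (B : set R), [/\ 0 <= s <= u, measurable B & A = W s @^-1` B]].

(* natural filtration of W satisfying the usual conditions:
   augmented by P-null sets and made right-continuous *)
Definition Fnat (t : R) : set (set T) :=
  [set A | forall u, t < u -> <<s raw_gen u `|` P.-negligible >> A].

Definition is_std_BM : Prop :=
  [/\ (forall t, measurable_fun setT (W t)),
      (forall w, W 0 w = 0),
      (forall w, {within [set t : R | 0 <= t], continuous (fun t => W t w)}),
      (forall s t, 0 <= s -> s < t -> forall B : set R, measurable B ->
          P ((fun w => W t w - W s w) @^-1` B) = normal_prob 0 (Num.sqrt (t - s)) B)
    & (forall s t, 0 <= s -> s <= t -> forall (A : set T) (B : set R),
          <<s raw_gen s >> A -> measurable B ->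
          P (A `&` (fun w => W t w - W s w) @^-1` B) =
          (P A * P ((fun w => (W t w - W s w)%R) @^-1` B))%E)].

(* geometric Brownian motion started at x (explicit strong solution) *)
Definition S (x t : R) (w : T) : R :=
  x * expR ((r - sig ^+ 2 / 2) * t + sig * W t w).

Definition dd : R := 2 * r / sig ^+ 2.
Definition ahat : R := K / (1 + 1 / dd).
Definition Pp (y : R) : R := Num.max (- (ahat / y) `^ (1 + dd)) (-1).
Definition fcost (y th : R) : R := (th - Pp y) ^+ 2 * sig ^+ 2 * y ^+ 2.

Definition hitE (A : set R) : set (\bar R) := (fun t : R => t%:E) @` A.

Definition tauI (x : R) (w : T) : \bar R :=
  ereal_inf (hitE [set t | 0 <= t /\ ~ (a < S x t w < b)]).

Definition is_stopping (tau : T -> \bar R) : Prop :=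
  (forall w, (0 <= tau w)%E) /\
  (forall t, 0 <= t -> Fnat t [set w | (tau w <= t%:E)%E]).

Definition run_int (tau : T -> \bar R) (x : R) (F : R -> R) (w : T) : \bar R :=
  (\int[lebesgue_measure]_(u in [set u : R | (0 <= u)%R /\ (u%:E <= tau w)%E])
      (expR (- (2 * r * u)) * F (S x u w))%R%:E)%E.

Definition Expect (X : T -> \bar R) : \bar R := (\int[P]_w X w)%E.

Definition gam1 (x : R) : R :=
  fine (Expect (run_int (tauI x) x (fun y => sig ^+ 2 * y ^+ 2))).
Definition gam2 (x : R) : R :=
  fine (Expect (run_int (tauI x) x (fun y => Pp y * sig ^+ 2 * y ^+ 2))).
Definition gam3 (x : R) : R :=
  fine (Expect (run_int (tauI x) x (fun y => Pp y ^+ 2 * sig ^+ 2 * y ^+ 2))).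

Definition Mfun (y : R) : R :=
  if (a < y) && (y < b) then gam3 y - gam2 y ^+ 2 / gam1 y else 0.

Definition terminal (tau : T -> \bar R) (x : R) (w : T) : \bar R :=
  match tau w with
  | t%:E => (expR (- (2 * r * t)) * Mfun (S x t w))%:E
  | _ => 0%E
  end.

Definition Cost (x h : R) (tau : T -> \bar R) : \bar R :=
  Expect (fun w => (run_int tau x (fun y => fcost y h) w + terminal tau x w)%E).

Definition Tadm (x : R) : set (T -> \bar R) :=
  [set tau | is_stopping tau /\ {ae P, forall w, (tau w <= tauI x w)%E}].

Definition Vfun (x h : R) : \bar R := ereal_inf [set Cost x h tau | tau in Tadm x].

Definition Cset (h : R) : set R :=
  [set y | a <= y <= b /\ (Vfun y h < (Mfun y)%:E)%E].
Definition Dset (h : R) : set R :=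
  [set y | a <= y <= b /\ Vfun y h = (Mfun y)%:E].

Definition taustar (x h : R) (w : T) : \bar R :=
  ereal_inf (hitE [set t | 0 <= t /\ Dset h (S x t w)]).

Definition ghat1 (h x : R) : R :=
  fine (Expect (run_int (taustar x h) x (fun y => sig ^+ 2 * y ^+ 2))).
Definition ghat2 (h x : R) : R :=
  fine (Expect (run_int (taustar x h) x (fun y => Pp y * sig ^+ 2 * y ^+ 2))).
Definition Gammahat (h x : R) : R := ghat2 h x / ghat1 h x.

Definition Gfun (x h : R) : R :=
  sig ^+ 2 / 2 * x ^+ 2 * derive1 (derive1 Mfun) x + r * x * derive1 Mfun x
  - 2 * r * Mfun x + fcost x h.

Definition AssumptionZ : Prop :=
  forall h, Pp a <= h <= Pp b ->
  forall x1 x2 x3, a < x1 < b -> a < x2 < b -> a < x3 < b ->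
  Gfun x1 h = 0 -> Gfun x2 h = 0 -> Gfun x3 h = 0 ->
  [\/ x1 = x2, x1 = x3 | x2 = x3].

End Model.

(* Main.v *)
Require Import Defs.
From HB Require Import structures.
From mathcomp Require Import all_boot all_order all_algebra.
From mathcomp Require Import all_classical all_reals all_analysis.
From mathcomp Require Import measurable_realfun ring lra.
Set Implicit Arguments. Unset Strict Implicit. Unset Printing Implicit Defensive.
Import Order.TTheory GRing.Theory Num.Theory.
Import numFieldNormedType.Exports.
Local Open Scope classical_set_scope.
Local Open Scope ring_scope.

(** For a fixed stopping time [tau] the expected cost is a quadratic polynomial
    in [h], whose minimiser is a weighted average of [P'] along the path, hence
    interior; so it suffices that [taustar] is optimal for the minimising [h]
    and that the latter has [x] in its continuation region.

    On [a, b] the running costs are sums of powers [y `^ p], for which Dynkin's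
    formula follows from optional stopping of exponential martingales.  Writing
    [G1], [G2], [G3] for the explicit potentials gamma_1, gamma_2, gamma_3, this
    gives
      Cost(x, h, tau) = Q_h(x) - E[exp(-2 r tau) g_h(S_tau)]
    with [Q_h = h^2 G1 - 2 h G2 + G3] and [g_h = (h G1 - G2)^2 / G1 = Q_h - M].
    The functions [al y^k1 + be y^k2] harmonic for the killed generator are
    affine in the scale [y^(k2 - k1)] after division by [y^k1].  A harmonic
    majorant of [g_h] touching it on both sides of [x] bounds the cost from
    below for every stopping time, and the exit time from the interval between
    two touching points attains the bound; this determines the continuation
    region around [x] without any use of assumption (Z). *)

(** * Integration *)

(** Only the minimiser [hs] requires an optimal time: if [tau] is optimal for [hs], every [h] has
    V(x, h) <= Cost(x, h, tau), so [hs] minimises over H a parabola whose vertex is interior. What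
    must be excluded is that x is a stopping point for [hs], where [taustar] is 0 and the parabola
    degenerates. The hedge h0 = G2(x) / G1(x) does this: g_h0(x) = 0, yet some time gains a positive
    amount, because P' is strictly increasing and so g_h0 is not identically 0. Hence V(x, hs) <=
    V(x, h0) < M(x), as M does not depend on the hedge. Powers suffice because a >= ahat: on [a, b],
    P'(y) is a constant times y^(-(1+d)), so the weights are multiples of y^2, y^(1-d) and y^(-2d),
    and a discounted power of S is a deterministic exponential times an exponential martingale. The
    filtration is augmented and right-continuous, whereas independence of increments is given for
    raw events, and the cost of an admissible time need not be measurable. This forces the delayed
    grid, the passage to raw events and the regularisation of stopping times. *)

Section integration.
Context {d} {T : measurableType d} {R : realType}.
Variable mu : {measure set T -> \bar R}.
Local Open Scope ereal_scope.

Import HBNNSimple.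

(** Measurability of [X] and [Y] is not assumed, since the cost of an arbitrary admissible time need
    not be measurable. The integral of a nonnegative function is a supremum over simple functions
    below it; such a function below [X], cut to 0 on [N], lies below [Y] and keeps its integral. *)
Lemma integral_eq_off_null (X Y : T -> \bar R) (N : set T) :
  measurable N -> mu N = 0 -> (forall w, ~ N w -> X w = Y w) ->
  \int[mu]_w X w = \int[mu]_w Y w.
Proof.
move=> mN N0 XY.
have half (X' Y' : T -> \bar R) : (forall w, 0 <= X' w) -> (forall w, 0 <= Y' w) ->
    (forall w, ~ N w -> X' w = Y' w) -> \int[mu]_w X' w <= \int[mu]_w Y' w.
  move=> X0 Y0 XY'; rewrite !ge0_integralTE//.
  apply: ge_ereal_sup => _ [h /= hX <-].
  pose h' : {nnsfun T >-> R} := proj_nnsfun h (measurableC mN).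
  have -> : sintegral mu h = sintegral mu h'.
    rewrite -!integralT_nnsfun; apply: ge0_ae_eq_integral => //.
    - exact/measurable_EFinP.
    - exact/measurable_EFinP.
    - by move=> w _; rewrite lee_fin.
    - by move=> w _; rewrite lee_fin.
    exists N; split => // w /= /not_implyP[_ /eqP].
    apply: contraNP => Nw; rewrite /h' /= mindicE.
    by rewrite mem_set ?mulr1.
  apply: ereal_sup_ubound; exists h' => //= w; rewrite mindicE.
  have [/set_mem Nw|Nw] := boolP (w \in ~` N).
    by rewrite mulr1 -XY'.
  by rewrite mulr0.
have full (X' Y' : T -> \bar R) : (forall w, 0 <= X' w) -> (forall w, 0 <= Y' w) ->
    (forall w, ~ N w -> X' w = Y' w) -> \int[mu]_w X' w = \int[mu]_w Y' w.
  move=> X0 Y0 XY'; apply/eqP; rewrite eq_le !half// => w Nw.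
  by rewrite XY'.
rewrite integralE [RHS]integralE; congr (_ - _); apply: full => w //= Nw.
  by rewrite !funeposE XY.
by rewrite !funenegE XY.
Qed.
End integration.

(** * Independent products and the Gaussian exponential moment *)

Section independent_product.
Context {d} {T : measurableType d} {R : realType}.
Variable P : probability T R.
Local Open Scope ereal_scope.

(** The law of the pair agrees with the product of the two laws on rectangles, hence everywhere;
    Tonelli then factors the integral. *)
Lemma ge0_expectation_indepM (X Y : T -> R) :
  measurable_fun setT X -> measurable_fun setT Y ->
  (forall w, 0 <= X w)%R -> (forall w, 0 <= Y w)%R ->
  (forall A B, measurable A -> measurable B ->
     P (X @^-1` A `&` Y @^-1` B) = P (X @^-1` A) * P (Y @^-1` B)) ->
  \int[P]_w (X w * Y w)%:E = \int[P]_w (X w)%:E * \int[P]_w (Y w)%:E.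
Proof.
move=> mX mY X0 Y0 ind.
have mXY : measurable_fun setT (fun w => (X w, Y w)).
  exact: measurable_fun_pair.
pose X' : {RV P >-> R} := mfun_Sub (mem_set mX).
pose Y' : {RV P >-> R} := mfun_Sub (mem_set mY).
pose XY' : {RV P >-> (R * R)%type} := mfun_Sub (mem_set mXY).
pose PX : probability R R := distribution P X'.
pose PY : probability R R := distribution P Y'.
pose PXY : probability (R * R)%type R := distribution P XY'.
have prodE B : measurable B -> (PX \x PY) B = PXY B.
  by apply: product_measure_unique => A C mA mC; rewrite /PXY /PX /PY /distribution /pushforward/= -ind.
(* Clipping at 0 makes the integrand nonnegative on the whole plane, as Tonelli requires, and
   changes nothing on the range of the pair. *)
pose f := fun z : R * R => (Num.max z.1 0 * Num.max z.2 0)%R%:E.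
have mf : measurable_fun setT f.
  apply/measurable_EFinP; apply: measurable_funM; apply: measurable_maxr => //.
have f0 z : 0 <= f z by rewrite lee_fin mulr_ge0// le_max lexx orbT.
transitivity (\int[PXY]_z f z).
  rewrite /PXY ge0_integral_distribution//=.
  by apply: eq_integral => w _; rewrite /f/= !max_l.
rewrite -(@eq_measure_integral _ _ _ _ PXY (PX \x PY)); last first.
  by move=> A mA _; first [exact: prodE | exact/esym/prodE].
rewrite fubini_tonelli1//.
have mm : measurable_fun setT (fun x : R => (Num.max x 0)%:E).
  by apply/measurable_EFinP; apply: measurable_maxr.
have YE : \int[PY]_y (Num.max y 0)%:E = \int[P]_w (Y w)%:E.
  rewrite /PY ge0_integral_distribution//=.
    by apply: eq_integral => w _; rewrite /= max_l.
  by move=> y; rewrite lee_fin le_max lexx orbT.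
have XE : \int[PX]_y (Num.max y 0)%:E = \int[P]_w (X w)%:E.
  rewrite /PX ge0_integral_distribution//=.
    by apply: eq_integral => w _; rewrite /= max_l.
  by move=> y; rewrite lee_fin le_max lexx orbT.
rewrite -XE -YE /fubini_F.
under eq_integral.
  move=> x _; under eq_integral do rewrite /f/= EFinM.
  rewrite ge0_integralZl//; last 2 first.
  - by move=> y _; rewrite lee_fin le_max lexx orbT.
  - by rewrite lee_fin le_max lexx orbT.
  over.
rewrite ge0_integralZr//.
- by move=> y _; rewrite lee_fin le_max lexx orbT.
- by apply: integral_ge0 => y _; rewrite lee_fin le_max lexx orbT.
Qed.
End independent_product.

Section normal_mgf.
Context {R : realType}.
Local Notation mu := lebesgue_measure.

(** Completing the square: an exponential tilt of a centred Gaussian density shifts its mean by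
    [theta * s ^+ 2], up to a constant factor. *)
Lemma normal_pdf_tilt (s theta x : R) : s != 0 ->
  expR (theta * x) * normal_pdf 0 s x =
  expR (theta ^+ 2 * s ^+ 2 / 2) * normal_pdf (theta * s ^+ 2) s x.
Proof.
move=> s0; rewrite !normal_pdfE// mulrCA [RHS]mulrCA; congr (_ * _).
rewrite /normal_fun -!expRD; congr expR.
rewrite -mulr_natr; field.
by rewrite s0.
Qed.

Lemma normal_mgf (s theta : R) : s != 0 ->
  (\int[normal_prob 0 s]_x (expR (theta * x))%:E)%E =
  (expR (theta ^+ 2 * s ^+ 2 / 2))%:E.
Proof.
move=> s0.
have mE : measurable_fun setT (fun x : R => expR (theta * x)).
  by apply: measurableT_comp => //; exact: measurable_funM.
pose nu : probability _ R := normal_prob 0 s.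
have numu : nu `<< mu := normal_prob_dominates 0 s.
have RN : ae_eq mu setT (Radon_Nikodym_SigmaFinite.f nu mu)
    (fun x => (normal_pdf 0 s x)%:E).
  apply: integral_ae_eq => //.
  - exact: Radon_Nikodym_SigmaFinite.f_integrable.
  - by apply/measurable_EFinP; exact: measurable_normal_pdf.
  - by move=> E _ mE'; rewrite -Radon_Nikodym_SigmaFinite.f_integral.
rewrite -(@Radon_Nikodym_SigmaFinite.change_of_variables _ _ _ nu mu numu)//; last first.
  exact/measurable_EFinP.
transitivity (\int[mu]_x ((expR (theta ^+ 2 * s ^+ 2 / 2))%:E *
    (normal_pdf (theta * s ^+ 2) s x)%:E))%E.
  apply: ge0_ae_eq_integral => //.
  - apply: emeasurable_funM; first exact/measurable_EFinP.
    exact: measurable_int (Radon_Nikodym_SigmaFinite.f_integrable _).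
  - by apply: emeasurable_funM => //; apply/measurable_EFinP; exact: measurable_normal_pdf.
  - by move=> x _; rewrite mule_ge0 ?lee_fin ?expR_ge0// Radon_Nikodym_SigmaFinite.f_ge0.
  - by move=> x _; rewrite mule_ge0 ?lee_fin ?expR_ge0 ?normal_pdf_ge0.
  apply: filterS RN => x /= /(_ I) -> _.
  by rewrite -!EFinM normal_pdf_tilt.
rewrite ge0_integralZl ?lee_fin ?expR_ge0//.
- by rewrite integral_normal_pdf mule1.
- by apply/measurable_EFinP; exact: measurable_normal_pdf.
- by move=> x _; rewrite lee_fin normal_pdf_ge0.
Qed.
End normal_mgf.

(** * Brownian exponential martingales *)

Section generated_sigma_algebra.
Context {T : Type} (G : set (set T)).

Lemma gen_setC A : <<s G >> A -> <<s G >> (~` A).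
Proof. by rewrite -setTD; exact: sigma_algebraCD. Qed.

Lemma gen_setU A B : <<s G >> A -> <<s G >> B -> <<s G >> (A `|` B).
Proof.
move=> GA GB; rewrite -bigcup2E; apply: sigma_algebra_bigcup => -[|[|n]]//=.
exact: sigma_algebra0.
Qed.

Lemma gen_setI A B : <<s G >> A -> <<s G >> B -> <<s G >> (A `&` B).
Proof.
move=> GA GB; rewrite -(setCK (A `&` B)) setCI; apply: gen_setC.
by apply: gen_setU; [exact: (gen_setC GA)|exact: (gen_setC GB)].
Qed.

Lemma gen_bigcap (F : (set T)^nat) :
  (forall n, <<s G >> (F n)) -> <<s G >> (\bigcap_n F n).
Proof.
move=> GF; rewrite -(setCK (\bigcap_n _)) setC_bigcap; apply: gen_setC.
by apply: sigma_algebra_bigcup => n; exact: (gen_setC (GF n)).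
Qed.
End generated_sigma_algebra.

Section completion.
Context {d} {T : measurableType d} {R : realType}.
Variable P : probability T R.

(** The sets that differ from a member of [<<s G >>] by a negligible set form a sigma-algebra
    containing [G] and all negligible sets. This leads from the augmented filtration back to raw
    events, for which independence of increments is available. *)
Lemma generated_up_to_negligible (G : set (set T)) (A : set T) :
  <<s G `|` P.-negligible >> A ->
  exists2 A', <<s G >> A' & P.-negligible ((A `\` A') `|` (A' `\` A)).
Proof.
move: A; apply: smallest_sub; last first.
  move=> A [GA|NA].
    exists A; first exact: sub_sigma_algebra.
    by rewrite setDv setU0; exact: negligible_set0.
  exists set0; first exact: sigma_algebra0.
  by rewrite setD0 set0D setU0.
split.
- exists set0; first exact: sigma_algebra0.
  by rewrite setDv setU0; exact: negligible_set0.
- move=> A [A' GA' NA]; exists (setT `\` A').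
    exact: sigma_algebraCD.
  apply: negligibleS NA => w [[[_ nA] h]|[[_ nA'] h]].
    by right; split => //; apply: contrapT => ?; exact: h.
  by left; split => //; apply: contrapT => ?; exact: h.
- move=> F FG.
  have /choice[F' F'P] : forall n, exists A', <<s G >> A' /\
      P.-negligible ((F n `\` A') `|` (A' `\` F n)).
    by move=> n; have [A' ? ?] := FG n; exists A'.
  exists (\bigcup_n F' n).
    by apply: sigma_algebra_bigcup => n; exact: (F'P n).1.
  have /negligible_bigcup := fun n => (F'P n).2.
  apply: negligibleS => w [[[n _ Fn] nF']|[[n _ Fn] nF']].
    by exists n => //; left; split => // ?; apply: nF'; exists n.
  by exists n => //; right; split => // ?; apply: nF'; exists n.
Qed.
End completion.

Section brownian.
Context {d} {T : measurableType d} {R : realType}.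
Variables (P : probability T R) (W : R -> T -> R).
Hypothesis BM : is_std_BM P W.

Let mW t : measurable_fun setT (W t). Proof. by case: BM. Qed.

Lemma raw_gen_measurable u A : <<s raw_gen W u >> A -> measurable A.
Proof.
move: A; apply: smallest_sub; first exact: sigma_algebra_measurable.
move=> A [s [B [_ mB ->]]]; rewrite -[X in measurable X]setTI; exact: mW.
Qed.

Lemma raw_gen_mono u v : u <= v -> <<s raw_gen W u >> `<=` <<s raw_gen W v >>.
Proof.
move=> uv; apply: sub_sigma_algebra2 => A [s [B [/andP[s0 su] mB ->]]].
by exists s, B; split => //; rewrite s0 (le_trans su).
Qed.

Lemma raw_gen_preimage s u B : 0 <= s <= u -> measurable B ->
  <<s raw_gen W u >> (W s @^-1` B).
Proof. by move=> su mB; apply: sub_sigma_algebra; exists s, B. Qed.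

(** Paths of [W] are known to be continuous only on nonnegative times; freezing them at negative
    times makes them continuous on the whole line. *)
Definition Wpos t w := W (Num.max t 0) w.

Lemma Wpos_continuous w : continuous (Wpos ^~ w).
Proof.
have [_ _ cW _ _] := BM.
move=> t; rewrite /Wpos.
have := cW w => /subspace_continuousP/(_ (Num.max t 0)).
rewrite /= le_max lexx orbT => /(_ isT); apply: cvg_comp.
have mc : (fun u : R => Num.max u 0) @ t --> Num.max t 0.
  by apply: (@continuous_max R R id (cst 0)); [exact: cvg_id|exact: cvg_cst].
move=> A /= /mc; rewrite !near_simpl/=; apply: filterS => u; apply.
by rewrite /= le_max lexx orbT.
Qed.

Lemma measurable_Wpos t : measurable_fun setT (Wpos t).
Proof. exact: mW. Qed.

Lemma Wpos0 w : Wpos 0 w = 0.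
Proof. by have [_ W0 _ _ _] := BM; rewrite /Wpos maxxx. Qed.

Definition Zexp (th t : R) (w : T) := expR (th * Wpos t w - th ^+ 2 / 2 * t).

Lemma Zexp_continuous th w : continuous (Zexp th ^~ w).
Proof.
move=> t; apply: continuous_comp; last exact: continuous_expR.
apply: cvgB; first by apply: cvgM; [exact: cvg_cst|exact: Wpos_continuous].
by apply: cvgM; [exact: cvg_cst|exact: cvg_id].
Qed.

Lemma measurable_Zexp th t : measurable_fun setT (Zexp th t).
Proof.
apply: measurableT_comp => //; apply: measurable_funB => //.
by apply: measurable_funM => //; exact: measurable_Wpos.
Qed.

Lemma Zexp_gt0 th t w : 0 < Zexp th t w.
Proof. exact: expR_gt0. Qed.

Lemma increment_mgf th s t : 0 <= s -> s < t ->
  (\int[P]_w (expR (th * (W t w - W s w)))%:E)%E =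
  (expR (th ^+ 2 * (t - s) / 2))%:E.
Proof.
move=> s0 st; have [_ _ _ nW _] := BM.
have mD : @measurable_fun _ _ T (measurableTypeR R) setT (fun w => W t w - W s w).
  by have : measurable_fun setT (fun w => W t w - W s w) by exact: measurable_funB.
pose D' := @isMeasurableFun.Build _ _ T (measurableTypeR R) _ mD.
pose D : {RV P >-> measurableTypeR R} := HB.pack (fun w => W t w - W s w : measurableTypeR R) D'.
have ts0 : Num.sqrt (t - s) != 0 by rewrite gt_eqF// sqrtr_gt0 subr_gt0.
have := normal_mgf th ts0; rewrite sqr_sqrtr ?subr_ge0 ?ltW// => <-.
have -> : (\int[P]_w (expR (th * (W t w - W s w)))%:E =
    \int[distribution P D]_x (expR (th * x))%:E)%E.
  rewrite ge0_integral_distribution//.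
  by apply/measurable_EFinP; apply: measurableT_comp => //; exact: measurable_funM.
refine (@eq_measure_integral _ _ _ setT (normal_prob 0 (Num.sqrt (t - s))) (distribution P D) _ _).
move=> A mA _; exact: nW.
Qed.

(** After replacing [A] by a raw event [A'], Z_t factors into Z_s, the exponential of the increment
    and a constant. Z_s times the indicator of [A'] is independent of the increment, whose
    exponential moment cancels the constant. *)
Lemma Zexp_martingale th s t A : 0 <= s -> s <= t -> measurable A ->
  <<s raw_gen W s `|` P.-negligible >> A ->
  (\int[P]_(w in A) (Zexp th t w)%:E = \int[P]_(w in A) (Zexp th s w)%:E)%E.
Proof.
move=> s0; rewrite le_eqVlt => /predU1P[<-//|st] mA sA.
have [A' GA' NA] := generated_up_to_negligible sA.
have mA' := raw_gen_measurable GA'.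
have aeA (u : R) : (\int[P]_(w in A) (Zexp th u w)%:E =
                    \int[P]_(w in A') (Zexp th u w)%:E)%E.
  rewrite integral_mkcond [RHS]integral_mkcond.
  have [N [mN N0 AN]] := NA.
  apply: (integral_eq_off_null mN N0) => w Nw.
  rewrite !patchE; congr (if _ then _ else _).
  have : ~ ((A `\` A') `|` (A' `\` A)) w by move/AN.
  move=> h; apply/idP/idP => /set_mem ?; apply/mem_set; apply: contrapT => ?; apply: h.
    by left.
  by right.
rewrite !aeA.
have t0 : 0 <= t by rewrite (le_trans s0)// ltW.
pose X := fun w => Zexp th s w * \1_A' w.
pose Y := fun w => expR (th * (W t w - W s w)).
have mX : measurable_fun setT X.
  by apply: measurable_funM; [exact: measurable_Zexp|exact: measurable_indic].
have mY : measurable_fun setT Y.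
  by apply: measurableT_comp => //; apply: measurable_funM => //; exact: measurable_funB.
have X0 w : 0 <= X w by rewrite mulr_ge0// ltW// Zexp_gt0.
have Y0 w : 0 <= Y w by rewrite expR_ge0.
have ind B C : measurable B -> measurable C ->
    (P (X @^-1` B `&` Y @^-1` C) = P (X @^-1` B) * P (Y @^-1` C))%E.
  move=> mB mC.
  have [_ _ _ _ iW] := BM.
  pose C' := (fun y => expR (th * y)) @^-1` C.
  have mC' : measurable C'.
    have mE : measurable_fun setT (fun y : R => expR (th * y)).
      by apply: measurableT_comp => //; exact: measurable_funM.
    by rewrite -[X in measurable X]setTI; exact: mE.
  have -> : Y @^-1` C = (fun w => W t w - W s w) @^-1` C' by [].
  apply: iW => //; first exact: ltW.
  pose f := fun y => expR (th * y - th ^+ 2 / 2 * s).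
  have mf : measurable_fun setT f.
    by apply: measurableT_comp => //; apply: measurable_funB => //; exact: measurable_funM.
  (* [X] vanishes off [A'], so the complement of [A'] belongs to the preimage of [B] exactly when 0
     is in [B]. *)
  have -> : X @^-1` B = (A' `&` W s @^-1` (f @^-1` B)) `|`
                        (if 0 \in B then (setT `\` A') else set0).
    apply/seteqP; split => w /=.
      rewrite /X indicE; have [/set_mem Aw|] := boolP (w \in A').
        by rewrite mulr1 => Bw; left; split => //; move: Bw; rewrite /f /Zexp /Wpos max_l.
      rewrite notin_setE mulr0 => nA B0; right.
      by rewrite mem_set.
    move=> [[Aw]|].
      by rewrite /X indicE mem_set// mulr1 /f /Zexp /Wpos max_l.
    case: ifPn => // /set_mem B0 [_ nA].
    by rewrite /X indicE memNset// mulr0.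
  have GB : <<s raw_gen W s >> (A' `&` W s @^-1` (f @^-1` B)).
    apply: gen_setI => //.
    apply: raw_gen_preimage; first by rewrite s0 lexx.
    by rewrite -[X in measurable X]setTI; exact: mf.
  by apply: gen_setU => //; case: ifP => _; [exact: sigma_algebraCD|exact: sigma_algebra0].
have XE (u : R) : (\int[P]_(w in A') (Zexp th u w)%:E =
   \int[P]_w (Zexp th u w * \1_A' w)%:E)%E.
  rewrite integral_mkcond; apply: eq_integral => w _.
  by rewrite patchE indicE; case: ifP => _; rewrite ?mulr1 ?mulr0.
rewrite !XE.
have ZE w : Zexp th t w * \1_A' w = X w * Y w * expR (- (th ^+ 2 * (t - s) / 2)).
  rewrite /X /Y mulrAC -[RHS]mulrA [RHS]mulrAC; congr (_ * _).
  rewrite /Zexp mulrA -!expRD; congr expR; rewrite /Wpos !max_l//; by field.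
under eq_integral do rewrite ZE.
under eq_integral do rewrite EFinM.
rewrite ge0_integralZr ?lee_fin ?expR_ge0//.
- rewrite (ge0_expectation_indepM mX mY)// increment_mgf// -muleA -EFinM -expRD.
  by rewrite subrr expR0 mule1.
- by apply/measurable_EFinP; exact: measurable_funM.
- by move=> w _; rewrite lee_fin mulr_ge0.
Qed.

End brownian.

(** * Optional stopping *)

Section uniform_integrability.
Context {d} {T : measurableType d} {R : realType}.
Variable P : probability T R.

(** Fatou gives one inequality. For the other, X_n <= min(X_n, M) + X_n^2 / M, so truncation at
    level M loses at most C / M, and the truncated sequence converges by domination. *)
Lemma L2_bounded_cvg_expectation (X_ : (T -> R)^nat) (X : T -> R) (c C : R) :
  (forall n, measurable_fun setT (X_ n)) ->
  (forall n w, 0 <= X_ n w) ->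
  (forall w, X_ ^~ w @ \oo --> X w) ->
  (forall n, \int[P]_w (X_ n w)%:E = c%:E)%E ->
  (forall n, \int[P]_w (X_ n w ^+ 2)%:E <= C%:E)%E ->
  (\int[P]_w (X w)%:E = c%:E)%E.
Proof.
move=> mX_ X_0 X_X iX iX2.
have mX : measurable_fun setT X by exact: (measurable_fun_cvg mX_ (fun w _ => X_X w)).
have X0 w : 0 <= X w.
  by apply: (cvgr_to_ge (X_X w)); apply: nearW => n; exact: X_0.
have C0 : 0 <= C.
  by rewrite -lee_fin; apply: le_trans (iX2 0%N); apply: integral_ge0 => w _; rewrite lee_fin sqr_ge0.
apply/eqP; rewrite eq_le; apply/andP; split.
  have := @fatou _ _ _ P setT measurableT (fun n w => (X_ n w)%:E).
  have -> : limn_einf (fun n => \int[P]_w (X_ n w)%:E)%E = c%:E.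
    rewrite (_ : (fun n => _) = cst c%:E); last by apply/funext => n; rewrite iX.
    by have [] := cvg_limn_einf_sup (cvg_cst c%:E).
  under eq_integral.
    move=> w _.
    rewrite (_ : limn_einf _ = (X w)%:E); last first.
      have /cvg_limn_einf_sup[]// : (X_ n w)%:E @[n --> \oo] --> (X w)%:E.
      by apply: cvg_EFin; [exact: nearW|exact: X_X].
    over.
  apply => //.
    by move=> n; exact/measurable_EFinP.
  by move=> n w _; rewrite lee_fin.
apply/lee_addgt0Pr => e e0.
(* Large enough for C / M <= e; the added 1 keeps the level positive when C = 0. *)
pose M := C / e + 1.
have M0 : 0 < M by rewrite ltr_wpDl// divr_ge0// ltW.
pose Y_ n w := Num.min (X_ n w) M.
pose Y w := Num.min (X w) M.
have mY_ n : measurable_fun setT (Y_ n) by exact: measurable_minr.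
have mY : measurable_fun setT Y by exact: measurable_minr.
have cY : (\int[P]_w (Y_ n w)%:E @[n --> \oo] --> \int[P]_w (Y w)%:E)%E.
  apply: (@dominated_cvg _ _ _ P setT measurableT _ _ (cst M%:E)) => //.
  - by move=> n; exact/measurable_EFinP.
  - move=> w _; apply: cvg_EFin; first by apply: nearW.
    rewrite /Y_/Y/=.
    apply: (cvg_comp (X_ ^~ w) (fun x => Num.min x M) (X_X w)).
    by apply: (@continuous_min R R id (cst M) (X w)); [exact: cvg_id|exact: cvg_cst].
  - exact: finite_measure_integrable_cst.
  - move=> n w _; rewrite /Y_ /= lee_fin ger0_norm; first by rewrite ge_min lexx orbT.
    by rewrite le_min X_0 ltW.
have bnd n : (c%:E - (C / M)%:E <= \int[P]_w (Y_ n w)%:E)%E.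
  rewrite leeBlDr// -(iX n).
  apply: (@le_trans _ _ (\int[P]_w ((Y_ n w)%:E + (M^-1 * X_ n w ^+ 2)%:E))%E).
    apply: ge0_le_integral => //.
    - by move=> w _; rewrite lee_fin.
    - exact/measurable_EFinP.
    - apply: emeasurable_funD; first exact/measurable_EFinP.
      by apply/measurable_EFinP; apply: measurable_funM => //; exact: measurable_funX.
    - move=> w _; rewrite -EFinD lee_fin /Y_.
      case: (leP (X_ n w) M) => XM.
        by rewrite lerDl mulr_ge0 ?sqr_ge0// invr_ge0 ltW.
      rewrite (@le_trans _ _ (M^-1 * X_ n w ^+ 2))//; last by rewrite lerDr ltW.
      rewrite expr2 mulrA ler_peMl// mulrC ler_pdivlMr// mul1r ltW//.
  rewrite ge0_integralD//; last 4 first.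
  - by move=> w _; rewrite lee_fin le_min X_0 ltW.
  - exact/measurable_EFinP.
  - by move=> w _; rewrite lee_fin mulr_ge0 ?sqr_ge0// invr_ge0 ltW.
  - by apply/measurable_EFinP; apply: measurable_funM => //; exact: measurable_funX.
  apply: leeD => //.
  under eq_integral do rewrite EFinM.
  rewrite ge0_integralZl ?lee_fin ?invr_ge0 ?(ltW M0)//.
  - by rewrite mulrC EFinM; apply: lee_wpmul2l => //; rewrite lee_fin invr_ge0 ltW.
  - by apply/measurable_EFinP; exact: measurable_funX.
  - by move=> w _; rewrite lee_fin sqr_ge0.
have : (c%:E - (C / M)%:E <= \int[P]_w (Y w)%:E)%E.
  by apply: (cvge_to_ge cY); apply: nearW.
move=> h; rewrite -leeBlDr//.
apply: le_trans (le_trans h _).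
  apply: leeB => //; rewrite lee_fin ler_pdivrMr// /M mulrDr mulr1 mulrC divfK ?gt_eqF//.
  by rewrite lerDl ltW.
apply: ge0_le_integral => //.
- by move=> w _; rewrite lee_fin le_min X0 ltW.
- exact/measurable_EFinP.
- exact/measurable_EFinP.
- by move=> w _; rewrite lee_fin ge_min lexx.
Qed.
End uniform_integrability.

Section optional_stopping.
Context {d} {T : measurableType d} {R : realType}.
Variables (P : probability T R) (W : R -> T -> R).
Hypothesis BM : is_std_BM P W.
Variable tau : T -> \bar R.
Hypothesis stau : is_stopping P W tau.
Hypothesis mtau : measurable_fun setT tau.

Definition tcut (t : R) (w : T) : R := fine (Order.min (tau w) t%:E).

Let tau0 w : (0 <= tau w)%E. Proof. by case: stau. Qed.

Lemma tcutE t w : 0 <= t -> (tcut t w)%:E = Order.min (tau w) t%:E.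
Proof.
move=> t0; rewrite /tcut fineK// ge0_fin_numE ?le_min ?tau0//.
by rewrite gt_min ltry orbT.
Qed.

Lemma tcut_ge0 t w : 0 <= t -> 0 <= tcut t w.
Proof. by move=> t0; rewrite -lee_fin tcutE// le_min tau0 lee_fin. Qed.

Lemma tcut_le t w : 0 <= t -> tcut t w <= t.
Proof. by move=> t0; rewrite -lee_fin tcutE// ge_min lexx orbT. Qed.

Lemma tcut_stop t w : (tau w <= t%:E)%E -> (tcut t w)%:E = tau w.
Proof. by move=> tt; rewrite tcutE ?min_l// -lee_fin (le_trans (tau0 w)). Qed.

Lemma tcut_run t w : 0 <= t -> (t%:E <= tau w)%E -> tcut t w = t.
Proof. by move=> t0 tt; apply: EFin_inj; rewrite tcutE// min_r. Qed.

Lemma measurable_tcut t : measurable_fun setT (tcut t).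
Proof.
apply: (@measurableT_comp _ _ _ _ _ _ fine); first exact: fine_measurable.
exact: measurable_mine.
Qed.

(* The k-th grid decision looks at [tau] one step in the past: [Fnat] is
   right-continuous, so [tau <= t] is only known strictly after time [t]. *)
Fixpoint grid (delta : R) (k : nat) (w : T) : R :=
  if k is k'.+1 then
    if ((k'%:R * delta - delta)%:E < tau w)%E then k%:R * delta
    else grid delta k' w
  else 0.

(** The test that produced step k had the lower threshold (k - 2) delta, so it was passed as well.
    Thus on the event where the grid moves to step k + 1 it sits exactly at k delta. *)
Lemma grid_running delta k w : 0 <= delta ->
  ((k%:R * delta - delta)%:E < tau w)%E -> grid delta k w = k%:R * delta.
Proof.
move=> d0; case: k => [_|k]; first by rewrite mul0r.
move=> h; rewrite [LHS]/=; case: ifPn => //; rewrite -leNgt => h'.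
have := lt_le_trans h h'; rewrite lte_fin ltNge => /negP[].
by rewrite -natr1 mulrDl mul1r lerD2r lerDl.
Qed.

Lemma grid_bounds delta k w : 0 <= delta -> 0 <= grid delta k w <= k%:R * delta.
Proof.
move=> d0; elim: k => [|k /andP[IH1 IH2]]; first by rewrite mul0r lexx.
rewrite [grid _ _ _]/=; case: ifPn => _; first by rewrite lexx mulr_ge0.
rewrite IH1 (le_trans IH2)// ler_wpM2r// ler_nat; exact: leqnSn.
Qed.

(** One [delta] is the mesh and the other the delay of the test. Once a test fails, [tau] lies below
    the current threshold, and both the grid time and the cut time stay put. *)
Lemma grid_near delta k w : 0 <= delta ->
  `|grid delta k w - tcut (k%:R * delta) w| <= 2 * delta.
Proof.
move=> d0; elim: k => [|k IH].
  rewrite /= mul0r sub0r normrN ger0_norm ?tcut_ge0//.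
  by rewrite (le_trans (tcut_le _ _))// mulr_ge0.
have kd0 : 0 <= k%:R * delta by rewrite mulr_ge0.
have kd1 : k.+1%:R * delta = k%:R * delta + delta by rewrite -natr1 mulrDl mul1r.
have kd10 : 0 <= k.+1%:R * delta by rewrite mulr_ge0.
rewrite [grid _ _ _]/=; case: ifPn => h.
  have ub := tcut_le w kd10.
  have lb : k%:R * delta - delta <= tcut (k.+1%:R * delta) w.
    rewrite -lee_fin tcutE// le_min ltW//= lee_fin kd1.
    lra.
  rewrite ger0_norm ?subr_ge0//.
  rewrite kd1 in ub lb *; lra.
rewrite -leNgt in h.
have -> : tcut (k.+1%:R * delta) w = tcut (k%:R * delta) w.
  apply: EFin_inj; rewrite !tcutE// !min_l//.
    by rewrite (le_trans h)// lee_fin; lra.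
  by rewrite (le_trans h)// lee_fin kd1; lra.
exact: IH.
Qed.

Lemma measurable_running c : measurable [set w | (c%:E < tau w)%E].
Proof.
rewrite -[X in measurable X]setTI.
exact: (emeasurable_fun_o_infty measurableT mtau).
Qed.

Lemma measurable_Zexp_grid th delta k :
  measurable_fun setT (fun w => Zexp W th (grid delta k w) w).
Proof.
elim: k => [|k IH]; first exact: (measurable_Zexp BM).
pose A := [set w | ((k%:R * delta - delta)%:E < tau w)%E].
rewrite (_ : (fun _ => _) = fun w => if w \in A then Zexp W th (k.+1%:R * delta) w
   else Zexp W th (grid delta k w) w).
  apply: measurable_fun_if => //.
  - apply: (measurable_fun_bool true); rewrite setTI.
    have -> : (fun w => w \in A) @^-1` [set true] = A.
      by apply/seteqP; split => w /=; [move/set_mem|move/mem_set].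
    exact: measurable_running.
  - by apply: measurable_funTS; exact: (measurable_Zexp BM).
  - exact: measurable_funTS.
apply/funext => w; rewrite [grid _ _ _]/=; case: ifPn => h.
  by rewrite mem_set.
by rewrite memNset//=; exact/negP.
Qed.

(** On the event [A] where the test is passed, the grid moves from k delta to (k + 1) delta and the
    martingale property applies; off [A] nothing changes. *)
Lemma Zexp_grid_expectation th delta k : 0 < delta ->
  (\int[P]_w (Zexp W th (grid delta k w) w)%:E = 1)%E.
Proof.
move=> d0; elim: k => [|k IH].
  under eq_integral do rewrite /= /Zexp (Wpos0 BM) !mulr0 subr0 expR0.
  by rewrite integral_cst// mul1e; exact: probability_setT.
pose A := [set w | ((k%:R * delta - delta)%:E < tau w)%E].
have mA : measurable A by exact: measurable_running.
have split_int (f : T -> R) : measurable_fun setT f -> (forall w, 0 <= f w) ->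
   (\int[P]_w (f w)%:E = \int[P]_(w in A) (f w)%:E + \int[P]_(w in ~` A) (f w)%:E)%E.
  move=> mf f0; rewrite -ge0_integral_setU ?setUv//.
  - exact: measurableC.
  - exact/measurable_EFinP.
  - by move=> w _; rewrite lee_fin.
  - by apply/disj_set2P; rewrite setICr.
have mg := measurable_Zexp_grid.
have Z0 t (w : T) : 0 <= Zexp W th t w by rewrite expR_ge0.
rewrite split_int// -IH [RHS]split_int//; congr (_ + _)%E.
  transitivity (\int[P]_(w in A) (Zexp W th (k.+1%:R * delta) w)%:E)%E.
    by apply: eq_integral => w /set_mem; rewrite /A/= => ->.
  transitivity (\int[P]_(w in A) (Zexp W th (k%:R * delta) w)%:E)%E; last first.
    by apply: eq_integral => w /set_mem Aw; rewrite grid_running// ltW.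
  apply: (Zexp_martingale BM) => //.
  - by rewrite mulr_ge0// ltW.
  - by rewrite ler_pM2r// ler_nat.
  rewrite -(setCK A); apply: gen_setC.
  have -> : ~` A = [set w | (tau w <= (k%:R * delta - delta)%:E)%E].
    by apply/seteqP; split => w /=; rewrite /A/= leNgt => /negP.
  (* For k = 0 the threshold is negative and the event empty. For k = k' + 1 the event is in [Fnat]
     at time k' delta, hence in the augmented sigma-algebra of the strictly later time k delta. *)
  case: (k) => [|k'].
    rewrite (_ : [set _ | _] = set0); first exact: sigma_algebra0.
    apply/seteqP; split => w //=; rewrite mul0r sub0r => h.
    have := le_trans (tau0 w) h; rewrite lee_fin oppr_ge0 leNgt d0//.
  case: stau => _ /(_ (k'.+1%:R * delta - delta)).
  have -> : k'.+1%:R * delta - delta = k'%:R * delta.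
    by rewrite -natr1 mulrDl mul1r addrK.
  rewrite mulr_ge0 ?(ltW d0)// => /(_ isT) /(_ (k'.+1%:R * delta)); apply.
  by rewrite ltr_pM2r// ltr_nat.
apply: eq_integral => w /set_mem; rewrite /A/= => /negP h.
by rewrite (negbTE h).
Qed.

Lemma Zexp_sqr th t w : Zexp W th t w ^+ 2 = Zexp W (2 * th) t w * expR (th ^+ 2 * t).
Proof. by rewrite /Zexp expr2 -!expRD; congr expR; field. Qed.

(** Grids of mesh t / (n + 1) with n + 1 steps end at t and converge to the cut time along each
    path. By [Zexp_sqr] the square is again an exponential martingale, of parameter 2 th, up to a
    factor at most exp(th^2 t); this bounds second moments uniformly. *)
Theorem Zexp_optional_stopping th t : 0 <= t ->
  (\int[P]_w (Zexp W th (tcut t w) w)%:E = 1)%E.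
Proof.
rewrite le_eqVlt => /predU1P[<-|t0].
  under eq_integral.
    move=> w _; rewrite (_ : tcut 0 w = 0); last first.
      by apply/eqP; rewrite eq_le tcut_le// tcut_ge0.
    rewrite /Zexp (Wpos0 BM) !mulr0 subr0 expR0; over.
  by rewrite integral_cst// mul1e; exact: probability_setT.
pose del n : R := t / n.+1%:R.
have del0 n : 0 < del n by rewrite divr_gt0.
have delE n : n.+1%:R * del n = t by rewrite mulrC divfK.
pose X_ n w := Zexp W th (grid (del n) n.+1 w) w.
apply: (@L2_bounded_cvg_expectation _ _ _ P X_ _ 1 (expR (th ^+ 2 * t))).
- by move=> n; exact: measurable_Zexp_grid.
- by move=> n w; exact: expR_ge0.
- move=> w; apply: (@cvg_comp _ _ _ (fun n => grid (del n) n.+1 w) (Zexp W th ^~ w));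
    last exact: (Zexp_continuous BM).
  have : (fun n => 2 * del n) @ \oo --> (0 : R).
    rewrite -[X in _ --> X](mulr0 2); apply: cvgM; first exact: cvg_cst.
    rewrite -[X in _ --> X](mulr0 t); apply: cvgM; first exact: cvg_cst.
    exact: cvg_harmonic.
  move=> /cvgrPdist_le h; apply/cvgrPdist_le => e e0.
  near=> n.
  rewrite distrC.
  have := @grid_near (del n) n.+1 w (ltW (del0 n)); rewrite delE => /le_trans; apply.
  have : `|0 - 2 * del n| <= e by near: n; exact: h.
  by rewrite sub0r normrN ger0_norm// mulr_ge0// ltW.
- by move=> n; exact: Zexp_grid_expectation.
- move=> n; apply: (@le_trans _ _ (\int[P]_w
    ((Zexp W (2 * th) (grid (del n) n.+1 w) w)%:E * (expR (th ^+ 2 * t))%:E))%E).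
    apply: ge0_le_integral => //.
    + by move=> w _; rewrite lee_fin sqr_ge0.
    + apply/measurable_EFinP; apply: measurable_funX; exact: measurable_Zexp_grid.
    + by apply: emeasurable_funM => //; apply/measurable_EFinP; exact: measurable_Zexp_grid.
    + move=> w _; rewrite -EFinM lee_fin Zexp_sqr ler_wpM2l ?expR_ge0// ler_expR.
      rewrite ler_wpM2l ?sqr_ge0//.
      have /andP[_] := @grid_bounds (del n) n.+1 w (ltW (del0 n)).
      by rewrite delE.
  rewrite ge0_integralZr ?lee_fin ?expR_ge0//.
  + by rewrite Zexp_grid_expectation// mul1e.
  + by apply/measurable_EFinP; exact: measurable_Zexp_grid.
  + by move=> w _; rewrite lee_fin expR_ge0.
Unshelve. all: by end_near.
Qed.

End optional_stopping.

(** * Geometric Brownian motion and its exit times *)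

(** Lets a bound over all times be expressed by countably many events. *)
Lemma continuous_ge_rat {R : realType} (g : R -> R) (c : R) : continuous g ->
  (forall q : rat, c <= g (ratr q)) -> forall x, c <= g x.
Proof.
move=> cg gq x; rewrite leNgt; apply/negP => gx.
have oA : open (g @^-1` [set y | y < c]).
  by apply: open_comp => [y _|]; [exact: cg|exact: open_lt].
have [|y [+ [q _ qy]]] := @dense_rat R (g @^-1` [set y | y < c]) _ oA.
  by exists x.
by rewrite -qy /= ltNge gq.
Qed.

Section paths.
Context {d} {T : measurableType d} {R : realType}.
Variables (P : probability T R) (W : R -> T -> R) (r sig : R).
Hypothesis BM : is_std_BM P W.

(** Rounding time down to multiples of 1 / (n + 1) gives processes whose preimages are countable
    unions of rectangles; path continuity makes them converge to [X]. *)
Lemma joint_measurable (X : R -> T -> R) :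
  (forall t, measurable_fun setT (X t)) -> (forall w, continuous (X ^~ w)) ->
  measurable_fun setT (fun z : T * R => X z.2 z.1).
Proof.
move=> mX cX.
pose gr n (u : R) : R := (Num.floor (n.+1%:R * u))%:~R / n.+1%:R.
apply: (@measurable_fun_cvg _ _ _ _ (fun n (z : T * R) => X (gr n z.2) z.1)).
  move=> n _ B mB; rewrite setTI.
  rewrite (_ : _ @^-1` _ = \bigcup_(k : int)
      ((X (k%:~R / n.+1%:R) @^-1` B) `*`
       ((fun u : R => Num.floor (n.+1%:R * u)) @^-1` [set k]))); last first.
    apply/seteqP; split => [[w u] /= h|[w u] [k _ [/= h ku]]].
      by exists (Num.floor (n.+1%:R * u)).
    by rewrite /gr /= ku.
  apply: countable_bigcupT_measurable => // k.
  apply: measurableX.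
    by rewrite -[X in measurable X]setTI; exact: mX.
  rewrite (_ : _ @^-1` _ = [set u | (k%:~R / n.+1%:R <= u) && (u < (k + 1)%:~R / n.+1%:R)]).
    by rewrite -set_itvco.
  have n0 : 0 < n.+1%:R :> R by [].
  apply/seteqP; split => u /=.
    move=> <-; rewrite ler_pdivrMr// ltr_pdivlMr// !(mulrC u).
    by rewrite floor_le_tmp//= floorD1_gt.
  by rewrite ler_pdivrMr// ltr_pdivlMr// !(mulrC u) => /floor_def.
move=> [w u] _ /=; apply: (@cvg_comp _ _ _ (gr ^~ u) (X ^~ w)); last exact: cX.
apply/cvgrPdist_le => e e0.
have : (fun n => n.+1%:R^-1) @ \oo --> (0 : R) by exact: cvg_harmonic.
move=> /cvgrPdist_le/(_ e e0); apply: filterS => n.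
rewrite sub0r normrN ger0_norm ?invr_ge0//; apply: le_trans.
have n0 : 0 < n.+1%:R :> R by [].
have -> : u - gr n u = (n.+1%:R * u - (Num.floor (n.+1%:R * u))%:~R) / n.+1%:R.
  by rewrite /gr mulrBl mulrAC divff ?mul1r// gt_eqF.
rewrite normrM (ger0_norm (x := _^-1)) ?invr_ge0// ler_piMl ?invr_ge0//.
rewrite ger0_norm ?subr_ge0 ?floor_le_tmp//.
by rewrite lerBlDl ltW// -[X in _ + X]/(1%:~R) -intrD floorD1_gt.
Qed.

Definition Spos x t w := x * expR ((r - sig ^+ 2 / 2) * t + sig * Wpos W t w).

Lemma S_Spos x t w : 0 <= t -> S W r sig x t w = Spos x t w.
Proof. by move=> t0; rewrite /S /Spos /Wpos max_l. Qed.

Lemma Spos_continuous x w : continuous (Spos x ^~ w).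
Proof.
move=> t; apply: cvgM; first exact: cvg_cst.
apply: continuous_comp; last exact: continuous_expR.
apply: cvgD; apply: cvgM; [exact: cvg_cst|exact: cvg_id|exact: cvg_cst|].
exact: (Wpos_continuous BM).
Qed.

Lemma measurable_Spos x t : measurable_fun setT (Spos x t).
Proof.
apply: measurable_funM => //; apply: measurableT_comp => //.
apply: measurable_funD => //; apply: measurable_funM => //.
exact: (measurable_Wpos BM).
Qed.

Lemma Spos_gt0 x t w : 0 < x -> 0 < Spos x t w.
Proof. by move=> x0; rewrite mulr_gt0 ?expR_gt0. Qed.

Lemma S0 x w : S W r sig x 0 w = x.
Proof.
by rewrite /S; case: BM => _ -> *; rewrite !mulr0 addr0 expR0 mulr1.
Qed.

Local Notation exit := (tauI W r sig).

Lemma exit_ge0 l u x w : (0 <= exit l u x w)%E.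
Proof. by apply: le_ereal_inf_tmp => _ [t [t0 _] <-]; rewrite lee_fin. Qed.

Lemma before_exit l u x w t : 0 <= t -> (t%:E < exit l u x w)%E ->
  l < S W r sig x t w < u.
Proof.
move=> t0; apply: contraPT => h; apply/negP; rewrite -leNgt.
by apply: ereal_inf_lbound; exists t => //; split => //; exact/negP.
Qed.

(** Before the exit the path is in the open interval, and the closed bounds survive a limit of times
    from the left. Time 0 has no such times and is covered by the assumption on [x], which may be an
    endpoint. *)
Lemma until_exit l u x w t : l <= x <= u -> 0 <= t -> (t%:E <= exit l u x w)%E ->
  l <= S W r sig x t w <= u.
Proof.
move=> lxu; rewrite le_eqVlt => /predU1P[<- _|t0 tt]; first by rewrite S0.
have key (D : set R) : closed D -> `]l, u[ `<=` D -> D (Spos x t w).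
  move=> cD lD.
  have cl : closure (Spos x ^~ w @^-1` D) `<=` Spos x ^~ w @^-1` D.
    have /closure_id <- // : closed (Spos x ^~ w @^-1` D).
    by apply: preimage_closed => // s _; exact: Spos_continuous.
  apply: cl => B /nbhs_ballP[e /= e0 eB].
  have m0 : 0 < Num.min t (e / 2) by rewrite lt_min t0 divr_gt0.
  have ms : 0 <= t - Num.min t (e / 2) by rewrite subr_ge0 ge_min lexx.
  exists (t - Num.min t (e / 2)); split; last first.
    apply: eB; rewrite /ball/= opprB addrC subrK gtr0_norm//.
    by rewrite gt_min; apply/orP; right; rewrite ltr_pdivrMr// ltr_pMr// ltr1n.
  apply: lD; rewrite /= in_itv/= -S_Spos//.
  apply: before_exit => //; apply: lt_le_trans tt.
  by rewrite lte_fin ltrBlDr ltrDl.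
rewrite S_Spos ?(ltW t0)//; apply/andP; split.
  apply: (key [set y | l <= y]); first exact: closed_ge.
  by move=> y /=; rewrite in_itv/= => /andP[/ltW].
apply: (key [set y | y <= u]); first exact: closed_le.
by move=> y /=; rewrite in_itv/= => /andP[_ /ltW].
Qed.

(** If the path were still inside at time t, it would remain inside for a further [e] by continuity,
    and the exit time would be at least t + e. *)
Lemma at_exit l u x w t : exit l u x w = t%:E -> ~ (l < S W r sig x t w < u).
Proof.
move=> et; have t0 : 0 <= t by rewrite -lee_fin -et exit_ge0.
move=> h; have cS := @Spos_continuous x w t.
have : \forall s \near t, l < Spos x s w < u.
  move: h; rewrite S_Spos// => /andP[h1 h2].
  near=> s; apply/andP; split; near: s.
    exact: (cvgr_gt (Spos x t w)).
  exact: (cvgr_lt (Spos x t w)).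
move=> /nbhs_ballP[e /= e0 eB].
suff : ((t + e)%:E <= exit l u x w)%E.
  by rewrite et lee_fin leNgt ltrDl e0.
apply: le_ereal_inf_tmp => _ [s [s0 hs] <-].
have ts : t <= s.
  by rewrite -lee_fin -et; apply: ereal_inf_lbound; exists s.
rewrite lee_fin leNgt; apply/negP => se; apply: hs.
rewrite S_Spos//.
by apply: eB; rewrite /ball/= distrC ger0_norm ?subr_ge0// ltrBlDl.
Unshelve. all: by end_near.
Qed.

Lemma Spos_raw x s t c : 0 <= s <= t ->
  <<s raw_gen W t >> [set w | c <= Spos x s w] /\
  <<s raw_gen W t >> [set w | Spos x s w <= c].
Proof.
move=> st; have s0 : 0 <= s by case/andP: st.
pose f y := x * expR ((r - sig ^+ 2 / 2) * s + sig * y).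
have mf : measurable_fun setT f.
  apply: measurable_funM => //; apply: measurableT_comp => //.
  by apply: measurable_funD => //; exact: measurable_funM.
have SE w : Spos x s w = f (W s w) by rewrite /Spos /Wpos max_l.
split.
- rewrite (_ : [set w | _] = W s @^-1` (f @^-1` `[c, +oo[%classic)).
    apply: raw_gen_preimage => //.
    by rewrite -[X in measurable X]setTI; exact: mf.
  by apply/seteqP; split => w; rewrite /= in_itv/= andbT SE.
- rewrite (_ : [set w | _] = W s @^-1` (f @^-1` `]-oo, c]%classic)).
    apply: raw_gen_preimage => //.
    by rewrite -[X in measurable X]setTI; exact: mf.
  by apply/seteqP; split => w; rewrite /= in_itv/= SE.
Qed.

(** By compactness of [0, t], no exit up to t means that the path keeps a distance 1 / (n + 1) from
    both endpoints for some n. By continuity this can be tested at rational times, clamped to [0, t]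
    by [cl], so the event is a countable combination of raw ones. Codes [k] of no rational
    contribute [setT]. *)
Lemma exit_le_raw l u x t : 0 <= t ->
  <<s raw_gen W t >> [set w | (exit l u x w <= t%:E)%E].
Proof.
move=> t0.
pose cl (v : R) := Num.max 0 (Num.min t v).
have cl0 v : 0 <= cl v <= t.
  by rewrite le_max lexx/= ge_max t0 ge_min lexx.
have clE v : 0 <= v <= t -> cl v = v.
  by move=> /andP[v0 vt]; rewrite /cl min_r// max_r.
have ccl : continuous cl.
  move=> v; apply: (@continuous_max R R (cst 0) (fun v => Num.min t v)); first exact: cvg_cst.
  by apply: (@continuous_min R R (cst t) id); [exact: cvg_cst|exact: cvg_id].
have cS w : continuous (fun v => Spos x (cl v) w).
  by move=> v; apply: (@continuous_comp _ _ _ cl (Spos x ^~ w)); [exact: ccl|exact: Spos_continuous].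
pose F (n : nat) (k : nat) : set T :=
  if @unpickle rat k is Some q then
    [set w | l + n.+1%:R^-1 <= Spos x (cl (ratr q)) w] `&`
    [set w | Spos x (cl (ratr q)) w <= u - n.+1%:R^-1]
  else setT.
have -> : [set w | (exit l u x w <= t%:E)%E] = ~` (\bigcup_n \bigcap_k F n k).
  apply/seteqP; split => w /=.
    move=> et [n _ Fn].
    have : exit l u x w \is a fin_num.
      by rewrite ge0_fin_numE ?exit_ge0// (le_lt_trans et)// ltry.
    move=> /fineK eE; rewrite -eE in et.
    have e0 : 0 <= fine (exit l u x w) by rewrite fine_ge0 ?exit_ge0.
    apply: (at_exit (esym eE)); rewrite S_Spos//.
    have n0 : 0 < n.+1%:R^-1 :> R by rewrite invr_gt0.
    have H v : l + n.+1%:R^-1 <= Spos x (cl v) w.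
      apply: (continuous_ge_rat (cS w)) => q.
      by have := Fn (pickle q) I; rewrite /F pickleK => -[].
    have H' v : - (u - n.+1%:R^-1) <= - Spos x (cl v) w.
      apply: (@continuous_ge_rat _ (fun v => - Spos x (cl v) w)).
        by move=> y; apply: cvgN; exact: cS.
      by move=> q; have := Fn (pickle q) I; rewrite /F pickleK lerN2 => -[].
    have := H (fine (exit l u x w)); have := H' (fine (exit l u x w)).
    rewrite clE; last by rewrite e0 -lee_fin.
    move: n0 => /[swap] /[swap]; set c := n.+1%:R^-1; move=> h1 h2 c0.
    apply/andP; split; lra.
  apply: contra_notP => /negP; rewrite -ltNge => te.
  pose g v := Num.min (Spos x (cl v) w - l) (u - Spos x (cl v) w).
  have cg : continuous g.
    move=> v; apply: (@continuous_min R R (fun v => Spos x (cl v) w - l) (fun v => u - Spos x (cl v) w)).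
      by apply: cvgB; [exact: cS|exact: cvg_cst].
    by apply: cvgB; [exact: cvg_cst|exact: cS].
  have [c _ cmin] := EVT_min t0 (continuous_subspaceT cg).
  have g0 v : 0 < g v.
    have /andP[v0 vt] := cl0 v.
    have := @before_exit l u x w (cl v) v0; rewrite S_Spos// => h.
    have /andP[h1 h2] : l < Spos x (cl v) w < u.
      by apply: h; apply: le_lt_trans te; rewrite lee_fin.
    by rewrite /g lt_min !subr_gt0 h1.
  have : (fun n => n.+1%:R^-1) @ \oo --> (0 : R) by exact: cvg_harmonic.
  move=> /cvgrPdist_le/(_ _ (g0 c))[N _ /(_ N (leqnn N))].
  rewrite sub0r normrN ger0_norm ?invr_ge0// => Nc.
  exists N => // k _; rewrite /F; case: unpickle => // q.
  have := cmin (cl (ratr q)); rewrite in_itv/= cl0 => /(_ isT).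
  move=> /(le_trans Nc); rewrite /g (clE (cl _)) ?cl0// le_min => /andP[].
  set y := Spos _ _ _; set c' := _^-1 => h1 h2; split => /=; lra.
apply: gen_setC; apply: sigma_algebra_bigcup => n; apply: gen_bigcap => k.
rewrite /F; case: unpickle => [q|].
  by apply: gen_setI; [have [] := Spos_raw x (l + n.+1%:R^-1) (cl0 (ratr q))
    |have [] := Spos_raw x (u - n.+1%:R^-1) (cl0 (ratr q))].
by have := gen_setC (@sigma_algebra0 _ setT (raw_gen W t)); rewrite setC0.
Qed.

Lemma measurable_nonneg_time (tau : T -> \bar R) :
  (forall w, 0 <= tau w)%E ->
  (forall t, 0 <= t -> measurable [set w | (tau w <= t%:E)%E]) ->
  measurable_fun setT tau.
Proof.
move=> tau0 mt _; apply: (measurability _ (ErealGenOInfty.measurableE R)) => //.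
move=> _ [_ [t ->] <-]; rewrite setTI.
have [t0|t0] := leP 0 t; last first.
  rewrite (_ : _ @^-1` _ = setT)//; apply/seteqP; split => w //= _.
  by rewrite in_itv/= andbT (lt_le_trans _ (tau0 w))// lte_fin.
rewrite (_ : _ @^-1` _ = ~` [set w | (tau w <= t%:E)%E]).
  by apply: measurableC; exact: mt.
by apply/seteqP; split => w /=; rewrite in_itv/= andbT ltNge => /negP.
Qed.

Lemma exit_stopping l u x : is_stopping P W (exit l u x).
Proof.
split => [w|t t0]; first exact: exit_ge0.
move=> v tv; have := exit_le_raw l u x t0.
move=> /(@raw_gen_mono _ _ _ W _ _ (ltW tv)).
by apply: sub_sigma_algebra2 => A; left.
Qed.

Lemma measurable_exit l u x : measurable_fun setT (exit l u x).
Proof.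
apply: measurable_nonneg_time => [w|t t0]; first exact: exit_ge0.
by apply: (raw_gen_measurable BM); exact: exit_le_raw.
Qed.

Lemma exit_mono a b l u x w : a <= l -> u <= b ->
  (exit l u x w <= exit a b x w)%E.
Proof.
move=> al ub; apply: ereal_inf_le_tmp => _ [t [t0 h] <-].
exists t => //; split => // /andP[h1 h2]; apply: h.
by rewrite (le_lt_trans al)// (lt_le_trans h2).
Qed.

Lemma exit_gt0 l u x w : l < x < u -> (0 < exit l u x w)%E.
Proof.
move=> lxu; rewrite lt_neqAle exit_ge0 andbT; apply/eqP => /esym/at_exit.
by rewrite S0.
Qed.

Lemma exit_boundary l u x w t : l <= x <= u -> exit l u x w = t%:E ->
  S W r sig x t w = l \/ S W r sig x t w = u.
Proof.
move=> lxu et; have t0 : 0 <= t by rewrite -lee_fin -et exit_ge0.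
have := @until_exit l u x w t lxu t0; rewrite et lexx => /(_ isT)/andP[h1 h2].
have := at_exit et.
move: h1 h2; rewrite !le_eqVlt => /predU1P[->|h1]; first by left.
by move=> /predU1P[->|h2]; [right|rewrite h1 h2 => []].
Qed.

End paths.

(** * Discounted functionals of a stopping time *)

Section clipping.
Context {R : realType} (a b : R).
Hypothesis ab : a < b.

Definition clip (y : R) : R := Num.max a (Num.min b y).

Lemma clip_in y : a <= clip y <= b.
Proof. by rewrite le_max lexx/= ge_max (ltW ab) ge_min lexx. Qed.

Lemma clip_id y : a <= y <= b -> clip y = y.
Proof. by move=> /andP[ay yb]; rewrite /clip min_r// max_r. Qed.

Lemma continuous_clip : continuous clip.
Proof.
move=> v; apply: (@continuous_max R R (cst a) (fun v => Num.min b v)); first exact: cvg_cst.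
by apply: (@continuous_min R R (cst b) id); [exact: cvg_cst|exact: cvg_id].
Qed.

Lemma continuous_comp_clip (psi : R -> R) :
  {within `[a, b], continuous psi} -> continuous (psi \o clip).
Proof.
move=> /subspace_continuousP cpsi y.
have := cpsi (clip y); rewrite /= in_itv/= clip_in => /(_ isT); apply: cvg_comp.
move=> A /= /continuous_clip; rewrite !near_simpl/=; apply: filterS => u; apply.
by rewrite /= in_itv/= clip_in.
Qed.

Lemma bounded_comp_clip (psi : R -> R) : {within `[a, b], continuous psi} ->
  exists2 C, 0 <= C & forall y, `|psi (clip y)| <= C.
Proof.
move=> cpsi; have [M _ hM] := EVT_max (ltW ab) cpsi.
have [m _ hm] := EVT_min (ltW ab) cpsi.
exists (`|psi M| + `|psi m|); first by rewrite addr_ge0.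
move=> y; have cy : clip y \in `[a, b] by rewrite in_itv/= clip_in.
have h1 := hM _ cy; have h2 := hm _ cy.
have := ler_norm (psi M); have := ler_norm (- psi m); rewrite normrN.
have := normr_ge0 (psi M); have := normr_ge0 (psi m).
rewrite ler_norml; lra.
Qed.
End clipping.

Section functionals.
Context {d} {T : measurableType d} {R : realType}.
Variables (P : probability T R) (W : R -> T -> R) (r sig a b : R).
Hypotheses (BM : is_std_BM P W) (r0 : 0 < r) (ab : a < b).
Local Notation mu := (@lebesgue_measure R).
Local Notation Sp := (Spos W r sig).

Definition running (tau : T -> \bar R) (z : T * R) : bool :=
  (0 <= z.2) && (z.2%:E <= tau z.1)%E.

(* Composing with [clip] makes a function continuous on [a, b] bounded and
   continuous everywhere, and changes nothing before the exit from (a, b). *)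
Definition kern (tau : T -> \bar R) (x : R) (psi : R -> R) (z : T * R) : R :=
  if running tau z
  then expR (- (2 * r * z.2)) * psi (clip a b (Sp x z.2 z.1)) else 0.

Definition tdisc (tau : T -> \bar R) (x : R) (psi : R -> R) (w : T) : R :=
  match tau w with
  | t%:E => expR (- (2 * r * t)) * psi (clip a b (Sp x t w))
  | _ => 0
  end.

(** Strengthens [Tadm]: measurability is added and the bound by the exit time holds on every path,
    not just almost surely. *)
Definition good (tau : T -> \bar R) (x : R) :=
  [/\ measurable_fun setT tau, is_stopping P W tau &
      forall w, (tau w <= tauI W r sig a b x w)%E].

Lemma measurable_running_set tau : measurable_fun setT tau ->
  measurable [set z | running tau z].
Proof.
move=> mtau.
have m1 : measurable_fun setT (fun z : T * R => z.2%:E) by apply/measurable_EFinP.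
have m2 : measurable_fun setT (fun z : T * R => tau z.1).
  exact: measurableT_comp.
have -> : [set z | running tau z] =
   (fun z : T * R => z.2) @^-1` `[0, +oo[ `&` [set z | (z.2%:E <= tau z.1)%E].
  by apply/seteqP; split => z /=; rewrite /running in_itv/= andbT => /andP.
apply: measurableI.
  rewrite -[X in measurable X]setTI; exact: measurable_snd.
have mB : measurable_fun setT (fun z : T * R => z.2%:E <= tau z.1)%E.
  exact: measurable_fun_lee.
rewrite (_ : [set z | _] = (fun z : T * R => z.2%:E <= tau z.1)%E @^-1` [set true]).
  by rewrite -[X in measurable X]setTI; exact: mB.
by apply/seteqP; split => z.
Qed.

Lemma measurable_if_running tau (f : T * R -> R) : measurable_fun setT tau ->
  measurable_fun setT f ->
  measurable_fun setT (fun z => if running tau z then f z else 0).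
Proof.
move=> mtau mf; apply: measurable_fun_if => //.
- apply: (measurable_fun_bool true); rewrite setTI.
  by rewrite (_ : _ @^-1` _ = [set z | running tau z]); [exact: measurable_running_set|apply/seteqP; split => z].
- exact: measurable_funTS.
Qed.

Lemma measurable_kern tau x psi : measurable_fun setT tau ->
  {within `[a, b], continuous psi} -> measurable_fun setT (kern tau x psi).
Proof.
move=> mtau cpsi; apply: measurable_if_running => //.
apply: measurable_funM.
  apply: measurableT_comp => //; apply: measurable_funN.
  by apply: measurable_funM.
apply: (@measurableT_comp _ _ _ _ _ _ (psi \o clip a b)).
  by apply: continuous_measurable_fun; exact: continuous_comp_clip.
apply: (@joint_measurable _ _ _ (Sp x)) => [t|w]; first exact: (measurable_Spos r sig BM).
exact: (Spos_continuous BM).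
Qed.

Let r20 : 0 < 2 * r. Proof. by rewrite mulr_gt0. Qed.

(** The common dominating function of all kernels. Written with the exponential density, the
    discount factor vanishes at negative times and has known total mass. *)
Lemma integrable_discount (C : R) : 0 <= C ->
  (P \x mu)%E.-integrable setT
    (fun z => (C / (2 * r) * exponential_pdf (2 * r) z.2)%:E).
Proof.
move=> C0; have mE : measurable_fun setT
    (fun z : T * R => (C / (2 * r) * exponential_pdf (2 * r) z.2)%:E).
  apply/measurable_EFinP; apply: measurable_funM => //.
  apply: (@measurableT_comp _ _ _ _ _ _ (exponential_pdf (2 * r))) => //.
  exact: measurable_exponential_pdf.
apply/integrable12ltyP => //.
under eq_integral.
  move=> w _.
  rewrite (_ : (\int[_]_y _)%E = (C / (2 * r))%:E); last first.
    under eq_integral.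
      move=> u _; rewrite /= ger0_norm; last first.
        by rewrite mulr_ge0 ?divr_ge0 ?exponential_pdf_ge0// ltW.
      rewrite EFinM; over.
    rewrite ge0_integralZl ?lee_fin ?divr_ge0 ?(ltW r20)//.
    - by rewrite integral_exponential_pdf// mule1.
    - by apply/measurable_EFinP; exact: measurable_exponential_pdf.
    - by move=> u _; rewrite lee_fin exponential_pdf_ge0// ltW.
  over.
rewrite integral_cst// (_ : (_ * _)%E = (C / (2 * r))%:E) ?ltry//.
by rewrite -[RHS]mule1; congr (_ * _)%E; exact: probability_setT.
Qed.

Lemma kern_bound tau x psi C : 0 <= C -> (forall y, `|psi (clip a b y)| <= C) ->
  forall z, `|kern tau x psi z| <= C / (2 * r) * exponential_pdf (2 * r) z.2.
Proof.
move=> C0 psiC z; rewrite /kern; case: ifPn => [/andP[z0 _]|_]; last first.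
  by rewrite normr0 mulr_ge0 ?divr_ge0 ?exponential_pdf_ge0// ltW.
rewrite exponential_pdfE// mulrA divfK ?gt_eqF// normrM ger0_norm ?expR_ge0//.
by rewrite mulrC mulNr ler_wpM2r ?expR_ge0.
Qed.

Lemma integrable_kern tau x psi : measurable_fun setT tau ->
  {within `[a, b], continuous psi} ->
  (P \x mu)%E.-integrable setT (EFin \o kern tau x psi).
Proof.
move=> mtau cpsi; have [C C0 psiC] := bounded_comp_clip ab cpsi.
apply: le_integrable (integrable_discount C0) => //.
  by apply/measurable_EFinP; exact: measurable_kern.
move=> z _ /=; rewrite lee_fin [leRHS]ger0_norm; first exact: kern_bound.
by rewrite mulr_ge0 ?divr_ge0 ?exponential_pdf_ge0// ltW.
Qed.

(** For a good time, the expected integral over [0, tau] of exp(-2 r u) psi(S_u), placed on the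
    product space so that either order of integration is at hand. *)
Definition LI tau x psi : R := fine (\int[(P \x mu)%E]_z (kern tau x psi z)%:E)%E.

Lemma LI_E tau x psi : measurable_fun setT tau ->
  {within `[a, b], continuous psi} ->
  (\int[(P \x mu)%E]_z (kern tau x psi z)%:E)%E = (LI tau x psi)%:E.
Proof.
move=> mtau cpsi; rewrite /LI fineK//.
by apply: integrable_fin_num => //; exact: integrable_kern.
Qed.

Lemma good_in tau x w t : a <= x <= b -> good tau x -> 0 <= t ->
  (t%:E <= tau w)%E -> a <= Sp x t w <= b.
Proof.
move=> axb [_ _ le_tau] t0 tt; rewrite -(S_Spos _ _ _ _ _ t0).
apply: (until_exit BM) => //; exact: le_trans (le_tau w).
Qed.

Lemma run_int_kern tau x psi w : a <= x <= b -> good tau x ->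
  run_int W r sig tau x psi w = (\int[mu]_u (kern tau x psi (w, u))%:E)%E.
Proof.
move=> axb gtau; rewrite /run_int integral_mkcond; apply: eq_integral => u _.
rewrite patchE /kern /running /=; case: ifPn => [/set_mem[u0 ut]|].
  by rewrite u0 ut S_Spos// clip_id//; exact: good_in gtau _ _.
rewrite notin_setE => h; case: ifPn => // /andP[u0 ut].
by exfalso; apply: h.
Qed.

Lemma Expect_run_int tau x psi : a <= x <= b -> good tau x ->
  {within `[a, b], continuous psi} ->
  Expect P (run_int W r sig tau x psi) = (LI tau x psi)%:E.
Proof.
move=> axb gtau cpsi; have mtau : measurable_fun setT tau by case: gtau.
rewrite -LI_E// /Expect; under eq_integral do rewrite run_int_kern//.
by rewrite -(integral12_prod_meas1 (integrable_kern _ mtau cpsi)).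
Qed.

Lemma LI_linear tau x (psi1 psi2 : R -> R) (k : R) : measurable_fun setT tau ->
  {within `[a, b], continuous psi1} -> {within `[a, b], continuous psi2} ->
  LI tau x (fun y => k * psi1 y + psi2 y) = k * LI tau x psi1 + LI tau x psi2.
Proof.
move=> mtau c1 c2; apply: EFin_inj; rewrite EFinD EFinM -!LI_E//; last first.
  move=> y; apply: cvgD; last exact: c2.
  by apply: cvgM; [exact: cvg_cst|exact: c1].
rewrite -integralZl//; last exact: integrable_kern.
rewrite -integralD//; last 2 first.
- by apply: integrableZl => //; exact: integrable_kern.
- exact: integrable_kern.
apply: eq_integral => z _; rewrite /kern -EFinM -EFinD; congr EFin.
by case: ifP => _; rewrite ?mulr0 ?addr0// mulrDr mulrCA.
Qed.

Lemma LI_ext tau x psi1 psi2 : (forall y, a <= y <= b -> psi1 y = psi2 y) ->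
  LI tau x psi1 = LI tau x psi2.
Proof.
move=> h; rewrite /LI; congr fine; apply: eq_integral => z _.
by rewrite /kern h// clip_in.
Qed.

End functionals.

(** * Dynkin's formula for powers *)

Lemma within_continuous_powR {R : realType} (a b p : R) : 0 < a ->
  {within `[a, b], continuous (fun y : R => y `^ p)}.
Proof.
move=> a0; apply: continuous_in_subspaceT => y; rewrite inE/= in_itv/= => /andP[ay _].
apply/differentiable_continuous/derivable1_diffP; apply: derivable_powR.
by rewrite in_itv/= andbT (lt_le_trans a0).
Qed.

Lemma integral_expR {R : realType} (lam rho : R) : lam != 0 -> 0 <= rho ->
  (\int[lebesgue_measure]_(u in `[0%R, rho]) (expR (lam * u))%:E)%E =
  ((expR (lam * rho) - 1) / lam)%:E.
Proof.
move=> l0; rewrite le_eqVlt => /predU1P[<-|rho0].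
  by rewrite set_itv1 integral_set1 mulr0 expR0 subrr mul0r.
have cE : continuous (fun u : R => expR (lam * u)).
  move=> u; apply: continuous_comp; last exact: continuous_expR.
  by apply: cvgM; [exact: cvg_cst|exact: cvg_id].
have cF : continuous (fun u : R => lam^-1 * expR (lam * u)).
  by move=> u; apply: cvgM; [exact: cvg_cst|exact: cE].
rewrite (@continuous_FTC2 _ _ (fun u => lam^-1 * expR (lam * u)))//.
- by rewrite -EFinB mulr0 expR0 -mulrBr mulrC.
- exact: continuous_subspaceT.
- split.
  + by move=> z _; exact: ex_derive.
  + by apply/cvg_at_right_filter; exact: cF.
  + by apply/cvg_at_left_filter; exact: cF.
- move=> z _; rewrite derive1Ml//.
  rewrite derive1_comp//.
  rewrite derive1E.
  have /funeqP -> := @derive_expR R.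
  by rewrite derive1Ml// derive1_id mulr1 mulrCA mulVf ?mulr1.
Qed.

Section dynkin.
Context {d} {T : measurableType d} {R : realType}.
Variables (P : probability T R) (W : R -> T -> R) (r sig a b : R).
Hypotheses (BM : is_std_BM P W) (r0 : 0 < r) (a0 : 0 < a) (ab : a < b).
Local Notation mu := (@lebesgue_measure R).
Local Notation Sp := (Spos W r sig).
Local Notation good := (good P W r sig a b).
Local Notation tdisc := (tdisc W r sig a b).
Local Notation kern := (kern W r sig a b).
Local Notation LI := (LI P W r sig a b).
Local Notation cont_ab psi := {within `[a, b], continuous psi}.

Definition Ycut tau x (psi : R -> R) (n : nat) w :=
  expR (- (2 * r * tcut tau n%:R w)) * psi (clip a b (Sp x (tcut tau n%:R w) w)).

Lemma measurable_Ycut tau x psi n : measurable_fun setT tau -> cont_ab psi ->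
  measurable_fun setT (Ycut tau x psi n).
Proof.
move=> mtau cpsi; apply: measurable_funM.
  apply: measurableT_comp => //; apply: measurable_funN.
  by apply: measurable_funM => //; exact: measurable_tcut.
apply: (@measurableT_comp _ _ _ _ _ _ (psi \o clip a b)).
  by apply: continuous_measurable_fun; exact: continuous_comp_clip.
apply: (@measurableT_comp _ _ _ _ _ _ (fun z => Sp x z.2 z.1) _ (fun w => (w, tcut tau n%:R w))).
  apply: (@joint_measurable _ _ _ (Sp x)) => [t|w]; first exact: (measurable_Spos r sig BM).
  exact: (Spos_continuous BM).
by apply: measurable_fun_pair => //; exact: measurable_tcut.
Qed.

Lemma Ycut_bound tau x psi C n w : is_stopping P W tau -> 0 <= C ->
  (forall y, `|psi (clip a b y)| <= C) -> `|Ycut tau x psi n w| <= C.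
Proof.
move=> stau C0 psiC; rewrite /Ycut normrM (ger0_norm (expR_ge0 _)).
rewrite -[leRHS]mul1r ler_pM ?expR_ge0// -expR0 ler_expR oppr_le0.
by rewrite mulr_ge0 ?mulr_ge0 ?(ltW r0)//; apply: (tcut_ge0 stau).
Qed.

(** If [tau] is finite the sequence is eventually constant; if it is infinite the discount sends the
    bounded values to 0, which is the value [tdisc] assigns there. *)
Lemma Ycut_cvg tau x psi w : is_stopping P W tau -> cont_ab psi ->
  Ycut tau x psi n w @[n --> \oo] --> tdisc tau x psi w.
Proof.
move=> stau cpsi; have [C C0 psiC] := bounded_comp_clip ab cpsi.
have tau0 := stau.1 w.
rewrite /tdisc /Ycut; case E: (tau w) => [t| |].
- apply: cvg_near_cst.
  near=> n; have tn : t <= n%:R by near: n; exact: nbhs_infty_ger.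
  have -> // : tcut tau n%:R w = t.
  by apply: EFin_inj; rewrite (tcut_stop stau)// E.
- have tE n : tcut tau n%:R w = n%:R by apply: (tcut_run stau); rewrite ?E ?leey.
  under eq_cvg do rewrite tE.
  (* The rate comes from exp(-y) <= 1 / y with y = 2 r n; the index is shifted by one to keep y
     positive. *)
  have : (fun n => C * (2 * r)^-1 * n.+1%:R^-1) @ \oo --> (0 : R).
    rewrite -[X in _ --> X](mulr0 (C * (2 * r)^-1)); apply: cvgM; first exact: cvg_cst.
    exact: cvg_harmonic.
  rewrite -[X in _ -> X]cvg_shiftS /=.
  move=> /cvgrPdist_le h; apply/cvgrPdist_le => e e0; apply: filterS (h e e0) => n.
  rewrite !sub0r !normrN; apply: le_trans.
  rewrite normrM (ger0_norm (expR_ge0 _)) [leRHS]ger0_norm; last first.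
    by rewrite !mulr_ge0 ?invr_ge0 ?mulr_ge0 ?(ltW r0).
  rewrite -[leRHS]mulrA [leLHS]mulrC; apply: ler_pM => //.
  rewrite -invfM expRN lef_pV2 ?posrE ?expR_gt0 ?mulr_gt0//.
  by rewrite (le_trans _ (expR_ge1Dx _))// lerDr.
- by move: tau0; rewrite E.
Unshelve. all: by end_near.
Qed.

Lemma measurable_tdisc tau x psi : measurable_fun setT tau -> is_stopping P W tau ->
  cont_ab psi -> measurable_fun setT (tdisc tau x psi).
Proof.
move=> mtau stau cpsi; apply: (@measurable_fun_cvg _ _ _ _ (Ycut tau x psi)).
  by move=> n; exact: measurable_Ycut.
by move=> w _; exact: Ycut_cvg.
Qed.

Lemma tdisc_bound tau x psi C w : is_stopping P W tau -> 0 <= C ->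
  (forall y, `|psi (clip a b y)| <= C) -> `|tdisc tau x psi w| <= C.
Proof.
move=> stau C0 psiC; rewrite /tdisc; have := stau.1 w.
case: (tau w) => [t| |]; rewrite ?normr0// lee_fin => t0.
rewrite normrM (ger0_norm (expR_ge0 _)).
rewrite -[leRHS]mul1r ler_pM ?expR_ge0// -expR0 ler_expR oppr_le0.
by rewrite mulr_ge0 ?mulr_ge0 ?(ltW r0).
Qed.

Lemma integrable_bounded (X : T -> R) (C : R) : measurable_fun setT X ->
  (forall w, `|X w| <= C) -> P.-integrable setT (EFin \o X).
Proof.
move=> mX XC; apply: (@le_integrable _ _ _ _ _ _ _ (cst C%:E)) => //.
- exact/measurable_EFinP.
- by move=> w _ /=; rewrite lee_fin (le_trans (XC w))// ler_norm.
- exact: finite_measure_integrable_cst.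
Qed.

Lemma integrable_tdisc tau x psi : measurable_fun setT tau -> is_stopping P W tau ->
  cont_ab psi -> P.-integrable setT (EFin \o tdisc tau x psi).
Proof.
move=> mtau stau cpsi; have [C C0 psiC] := bounded_comp_clip ab cpsi.
apply: (@integrable_bounded _ C); first exact: measurable_tdisc.
by move=> w; exact: tdisc_bound.
Qed.

(** For a good time, E[exp(-2 r tau) psi(S_tau)], with 0 where [tau] is infinite. *)
Definition TI tau x psi : R := fine (\int[P]_w (tdisc tau x psi w)%:E)%E.

Lemma TI_E tau x psi : measurable_fun setT tau -> is_stopping P W tau ->
  cont_ab psi -> (\int[P]_w (tdisc tau x psi w)%:E)%E = (TI tau x psi)%:E.
Proof.
move=> mtau stau cpsi; rewrite /TI fineK//.
by apply: integrable_fin_num => //; exact: integrable_tdisc.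
Qed.

Lemma TI_linear tau x (psi1 psi2 : R -> R) (k : R) :
  measurable_fun setT tau -> is_stopping P W tau ->
  cont_ab psi1 -> cont_ab psi2 ->
  TI tau x (fun y => k * psi1 y + psi2 y) = k * TI tau x psi1 + TI tau x psi2.
Proof.
move=> mtau stau c1 c2; apply: EFin_inj; rewrite EFinD EFinM -!TI_E//; last first.
  move=> y; apply: cvgD; last exact: c2.
  by apply: cvgM; [exact: cvg_cst|exact: c1].
rewrite -integralZl//; last exact: integrable_tdisc.
rewrite -integralD//; last 2 first.
- by apply: integrableZl => //; exact: integrable_tdisc.
- exact: integrable_tdisc.
apply: eq_integral => w _; rewrite /tdisc -EFinM -EFinD; congr EFin.
by case: (tau w) => [t| |]; rewrite ?mulr0 ?addr0// mulrDr mulrCA.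
Qed.

Lemma TI_ext tau x psi1 psi2 : (forall y, a <= y <= b -> psi1 y = psi2 y) ->
  TI tau x psi1 = TI tau x psi2.
Proof.
move=> h; rewrite /TI; congr fine; apply: eq_integral => w _.
by rewrite /tdisc; case: (tau w) => [t| |]//; rewrite h// clip_in.
Qed.

Lemma TI_le tau x psi1 psi2 : measurable_fun setT tau -> is_stopping P W tau ->
  cont_ab psi1 -> cont_ab psi2 ->
  (forall y, a <= y <= b -> psi1 y <= psi2 y) -> TI tau x psi1 <= TI tau x psi2.
Proof.
move=> mtau stau c1 c2 h; rewrite -lee_fin -!TI_E//.
apply: le_integral => //; [exact: integrable_tdisc|exact: integrable_tdisc|].
move=> w _; rewrite lee_fin /tdisc; case: (tau w) => [t| |]//.
by rewrite ler_wpM2l ?expR_ge0// h// clip_in.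
Qed.

End dynkin.

Lemma addIe_fin {R : numDomainType} (x y c : \bar R) : c \is a fin_num ->
  (x + c = y + c -> x = y)%E.
Proof. by move=> cf /(congr1 (fun v => v - c)%E); rewrite !addeK. Qed.

Section dynkin_formula.
Context {d} {T : measurableType d} {R : realType}.
Variables (P : probability T R) (W : R -> T -> R) (r sig a b : R).
Hypotheses (BM : is_std_BM P W) (r0 : 0 < r) (a0 : 0 < a) (ab : a < b).
Local Notation mu := (@lebesgue_measure R).
Local Notation Sp := (Spos W r sig).
Local Notation good := (good P W r sig a b).
Local Notation tdisc := (tdisc W r sig a b).
Local Notation kern := (kern W r sig a b).
Local Notation LI := (LI P W r sig a b).
Local Notation TI := (TI P W r sig a b).
Local Notation Ycut := (Ycut W r sig a b).
Local Notation cont_ab psi := {within `[a, b], continuous psi}.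

(** The eigenvalue of the killed generator L - 2r on the power y^p. *)
Definition lam (p : R) : R := sig ^+ 2 / 2 * p * (p - 1) + r * p - 2 * r.

Lemma discounted_powR x p u w : 0 < x ->
  expR (- (2 * r * u)) * Sp x u w `^ p =
  x `^ p * expR (lam p * u) * Zexp W (sig * p) u w.
Proof.
move=> x0; rewrite /Spos powRM ?expR_ge0 ?(ltW x0)// -expRM mulrCA -[RHS]mulrA; congr (_ * _).
rewrite -expRD /Zexp -expRD; congr expR; rewrite /lam; by field.
Qed.

Variables (tau : T -> \bar R) (x : R).
Hypotheses (axb : a <= x <= b) (gtau : good tau x).

Let mtau : measurable_fun setT tau. Proof. by case: gtau. Qed.
Let stau : is_stopping P W tau. Proof. by case: gtau. Qed.
Let x0 : 0 < x. Proof. by case/andP: axb => /(lt_le_trans a0). Qed.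

Definition taun (n : nat) (w : T) : \bar R := (tcut tau n%:R w)%:E.

Lemma measurable_taun n : measurable_fun setT (taun n).
Proof. by apply/measurable_EFinP; exact: measurable_tcut. Qed.

Lemma taun_le n w : (taun n w <= tau w)%E.
Proof. by rewrite /taun (tcutE stau)// ge_min lexx. Qed.

Lemma taun_in n w u : 0 <= u -> (u%:E <= taun n w)%E -> a <= Sp x u w <= b.
Proof.
move=> u0 un; apply: (good_in BM axb gtau) => //.
exact: le_trans (taun_le n w).
Qed.

Let Zc p n w := Zexp W (sig * p) (tcut tau n%:R w) w.

Let mZc p n : measurable_fun setT (Zc p n).
Proof.
apply: (@measurableT_comp _ _ _ _ _ _ (fun z : T * R => Zexp W (sig * p) z.2 z.1) _ (fun w => (w, tcut tau n%:R w))).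
  apply: joint_measurable => [t|w]; first exact: (measurable_Zexp BM).
  exact: (Zexp_continuous BM).
by apply: measurable_fun_pair => //; exact: measurable_tcut.
Qed.

Let mZ p : measurable_fun setT (fun z : T * R => Zexp W (sig * p) z.2 z.1).
Proof.
apply: joint_measurable => [t|w]; first exact: (measurable_Zexp BM).
exact: (Zexp_continuous BM).
Qed.

Lemma Ycut_powR p n w :
  Ycut tau x (fun y => y `^ p) n w =
  x `^ p * expR (lam p * tcut tau n%:R w) * Zc p n w.
Proof.
rewrite /Ycut clip_id ?discounted_powR//.
by apply: (taun_in (n := n)); [exact: (tcut_ge0 stau)|exact: lexx].
Qed.

(** The martingales stopped at min(tau, u) and at min(tau, n) both have expectation 1 and coincide
    off the event u <= min(tau, n), on which the first equals Z_u. Subtracting the finite common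
    part gives the claim without conditional expectations; for u > n both sides are 0. *)
Lemma Zexp_running p n u : 0 <= u ->
  (\int[P]_w (if running (taun n) (w, u) then Zexp W (sig * p) u w else 0)%:E =
   \int[P]_w (if running (taun n) (w, u) then Zc p n w else 0)%:E)%E.
Proof.
move=> u0; have [un|nu] := leP u n%:R; last first.
  apply: eq_integral => w _; rewrite /running /= u0 /taun lee_fin.
  by rewrite leNgt (le_lt_trans (tcut_le stau _ _))//.
pose A := [set w | running (taun n) (w, u)].
have mA : measurable A.
  have := measurable_running_set (measurable_taun n).
  have mp : measurable_fun setT (fun w : T => (w, u)) by exact: measurable_fun_pair.
  by move=> /(mp measurableT); rewrite setTI.
have split_int (f : T -> R) : measurable_fun setT f -> (forall w, 0 <= f w) ->
   (\int[P]_w (f w)%:E = \int[P]_(w in A) (f w)%:E + \int[P]_(w in ~` A) (f w)%:E)%E.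
  move=> mf f0; rewrite -ge0_integral_setU ?setUv//.
  - exact: measurableC.
  - exact/measurable_EFinP.
  - by move=> w _; rewrite lee_fin.
  - by apply/disj_set2P; rewrite setICr.
have restr (f : T -> R) : (\int[P]_w (if running (taun n) (w, u) then f w else 0)%:E =
    \int[P]_(w in A) (f w)%:E)%E.
  rewrite [RHS]integral_mkcond; apply: eq_integral => w _; rewrite patchE.
  by case: ifPn => h; [rewrite mem_set|rewrite memNset//; exact/negP].
rewrite !restr.
pose Zu w := Zexp W (sig * p) (tcut tau u w) w.
have mZu : measurable_fun setT Zu.
  apply: (@measurableT_comp _ _ _ _ _ _ (fun z : T * R => Zexp W (sig * p) z.2 z.1) _ (fun w => (w, tcut tau u w))) => //.
  by apply: measurable_fun_pair => //; exact: measurable_tcut.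
have Z0 t w : 0 <= Zexp W (sig * p) t w by exact: expR_ge0.
have h1 := Zexp_optional_stopping BM stau mtau (sig * p) u0.
have h2 := Zexp_optional_stopping BM stau mtau (sig * p) (ler0n R n).
rewrite (split_int Zu mZu (fun w => Z0 _ w)) in h1.
rewrite (split_int (Zc p n) (mZc p n) (fun w => Z0 _ w)) in h2.
have eqC : (\int[P]_(w in ~` A) (Zu w)%:E = \int[P]_(w in ~` A) (Zc p n w)%:E)%E.
  apply: eq_integral => w /set_mem; rewrite /A/= /running/= u0/= => /negP.
  rewrite -ltNge /taun => tu.
  have ttau : (tau w < u%:E)%E.
    move: tu; rewrite (tcutE stau)// gt_min lte_fin => /orP[//|].
    by rewrite ltNge un.
  have e : tcut tau u w = tcut tau n%:R w.
    apply: EFin_inj; rewrite (tcut_stop stau (ltW ttau)) (tcut_stop stau)//.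
    by rewrite (le_trans (ltW ttau))// lee_fin.
  by rewrite /Zu /Zc e.
have eqA : (\int[P]_(w in A) (Zu w)%:E = \int[P]_(w in A) (Zexp W (sig * p) u w)%:E)%E.
  apply: eq_integral => w /set_mem; rewrite /A/= /running/= u0/= => tu.
  have e : tcut tau u w = u.
    exact: (tcut_run stau u0 (le_trans tu (taun_le n w))).
  by rewrite /Zu e.
rewrite -eqA.
have Cfin : (\int[P]_(w in ~` A) (Zc p n w)%:E)%E \is a fin_num.
  have Zc0 B : (0 <= \int[P]_(w in B) (Zc p n w)%:E)%E.
    by apply: integral_ge0 => w _; rewrite lee_fin; exact: Z0.
  rewrite ge0_fin_numE; last exact: Zc0.
  apply: (@le_lt_trans _ _ 1%E); last exact: ltry.
  by rewrite -h2 leeDr.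
rewrite -h2 eqC in h1.
exact: (addIe_fin Cfin h1).
Qed.

(** With time as the outer variable, [Zexp_running] replaces the martingale at time u by its value
    at the cut time. With time as the inner variable, only a deterministic exponential remains to be
    integrated. *)
Lemma kern_taun_powR p n : 
  (\int[(P \x mu)%E]_z (kern (taun n) x (fun y => y `^ p) z)%:E =
   \int[P]_w ((x `^ p * Zc p n w)%:E *
     \int[mu]_(u in `[0%R, tcut tau n%:R w]) (expR (lam p * u))%:E))%E.
Proof.
pose f (z : T * R) := x `^ p * expR (lam p * z.2).
have mf : measurable_fun setT f.
  apply: measurable_funM => //; apply: measurableT_comp => //.
  by apply: measurable_funM.
have f0 z : 0 <= f z by rewrite mulr_ge0 ?powR_ge0 ?expR_ge0.
pose K1 z := (if running (taun n) z then f z * Zexp W (sig * p) z.2 z.1 else 0)%:E.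
pose K2 z := (if running (taun n) z then f z * Zc p n z.1 else 0)%:E.
have mK1 : measurable_fun setT K1.
  apply/measurable_EFinP; apply: (measurable_if_running (measurable_taun n)).
  exact: measurable_funM.
have mK2 : measurable_fun setT K2.
  apply/measurable_EFinP; apply: (measurable_if_running (measurable_taun n)).
  apply: measurable_funM => //; exact: (@measurableT_comp _ _ _ _ _ _ (Zc p n)).
have K10 z : (0 <= K1 z)%E.
  by rewrite lee_fin; case: ifP => // _; rewrite mulr_ge0// expR_ge0.
have K20 z : (0 <= K2 z)%E.
  by rewrite lee_fin; case: ifP => // _; rewrite mulr_ge0// expR_ge0.
transitivity (\int[(P \x mu)%E]_z K1 z)%E.
  apply: eq_integral => -[w u] _; rewrite /K1 /kern; case: ifPn => //= /andP[u0 un].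
  by rewrite clip_id ?discounted_powR//; exact: (taun_in u0 un).
transitivity (\int[(P \x mu)%E]_z K2 z)%E.
  rewrite (@fubini_tonelli2 _ _ _ _ _ P mu K1 mK1 K10) (@fubini_tonelli2 _ _ _ _ _ P mu K2 mK2 K20).
  apply: eq_integral => u _; rewrite /fubini_G.
  have [u0|u0] := leP 0 u; last first.
    by apply: eq_integral => w _; rewrite /K1 /K2 /running /= leNgt u0.
  have pull (g : T -> R) : measurable_fun setT g -> (forall w, 0 <= g w) ->
     (\int[P]_w (if running (taun n) (w, u) then f (w, u) * g w else 0)%:E =
      (x `^ p * expR (lam p * u))%:E * \int[P]_w (if running (taun n) (w, u) then g w else 0)%:E)%E.
    move=> mg g0; rewrite -ge0_integralZl//.
    - by apply: eq_integral => w _; rewrite -EFinM; case: ifP => _; rewrite ?mulr0.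
    - apply/measurable_EFinP.
      apply: (@measurableT_comp _ _ _ _ _ _ (fun z : T * R => if running (taun n) z then g z.1 else 0) _ (fun w => (w, u))).
        apply: (measurable_if_running (measurable_taun n)).
        exact: (@measurableT_comp _ _ _ _ _ _ g).
      exact: measurable_fun_pair.
    - by move=> w _; rewrite lee_fin; case: ifP.
    - by rewrite lee_fin mulr_ge0 ?powR_ge0 ?expR_ge0.
  rewrite /K1 /K2 /= (pull (Zexp W (sig * p) u))//; last 2 first.
  - exact: (measurable_Zexp BM).
  - by move=> w; exact: expR_ge0.
  rewrite (pull (Zc p n) (mZc p n) (fun w => expR_ge0 _)).
  by rewrite Zexp_running.
rewrite (@fubini_tonelli1 _ _ _ _ _ P mu K2 mK2 K20); apply: eq_integral => w _; rewrite /fubini_F /K2.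
have mE : measurable_fun setT (fun u : R => expR (lam p * u)).
  by apply: measurableT_comp => //; exact: measurable_funM.
rewrite -ge0_integralZl//.
- rewrite [RHS]integral_mkcond; apply: eq_integral => u _; rewrite patchE.
  have -> : (u \in `[0%R, tcut tau n%:R w]%classic) = running (taun n) (w, u).
    by rewrite /running /taun /= lee_fin; apply/idP/idP => [/set_mem|h]; rewrite ?inE /= in_itv/=.
  by case: ifP => // _; rewrite -EFinM /f/= mulrAC.
- by apply/measurable_EFinP; exact: measurable_funTS.
- by rewrite lee_fin mulr_ge0 ?powR_ge0 ?expR_ge0.
Qed.

(** Integrating exp(lam u) up to the cut time and multiplying by [lam p] leaves the stopped value
    minus x^p times the stopped martingale, whose expectation is 1. The case [lam p = 0] is optional
    stopping itself. *)
Lemma Dynkin_taun p n :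
  (\int[P]_w (Ycut tau x (fun y => y `^ p) n w)%:E)%E =
  (x `^ p + lam p * LI (taun n) x (fun y => y `^ p))%:E.
Proof.
have cp := @within_continuous_powR R a b p a0.
have iZ : (\int[P]_w (Zc p n w)%:E = 1)%E by exact: Zexp_optional_stopping.
have intZ : P.-integrable setT (EFin \o Zc p n).
  apply/integrableP; split; first exact/measurable_EFinP.
  under eq_integral do rewrite /= ger0_norm ?expR_ge0//.
  by rewrite iZ ltry.
have [l0|l0] := eqVneq (lam p) 0.
  rewrite l0 mul0r addr0.
  under eq_integral do rewrite Ycut_powR l0 mul0r expR0 mulr1 EFinM.
  by rewrite integralZl// iZ mule1.
have intY : P.-integrable setT (EFin \o Ycut tau x (fun y => y `^ p) n).
  have [C C0 psiC] := bounded_comp_clip ab cp.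
  apply: (@integrable_bounded _ _ _ _ _ C).
    by apply: (measurable_Ycut _ _ BM ab).
  by move=> w; by apply: Ycut_bound => //; exact: stau.
have /(congr1 (fun v => (lam p)%:E * v)%E) := kern_taun_powR p n.
rewrite LI_E//; last exact: measurable_taun.
have -> : (\int[P]_w ((x `^ p * Zc p n w)%:E *
    \int[mu]_(u in `[0%R, tcut tau n%:R w]) (expR (lam p * u))%:E) =
   \int[P]_w ((lam p)^-1%:E * ((Ycut tau x (fun y => y `^ p) n w)%:E - (x `^ p)%:E * (Zc p n w)%:E)))%E.
  apply: eq_integral => w _; rewrite integral_expR//; last exact: (tcut_ge0 stau).
  rewrite -!EFinM; congr EFin; rewrite Ycut_powR; field.
  exact: l0.
have intxZ : P.-integrable setT (fun w => (x `^ p)%:E * (Zc p n w)%:E)%E by exact: integrableZl.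
rewrite integralZl//; last exact: integrableB.
rewrite integralB// integralZl// iZ mule1 [in RHS]muleA -[in RHS]EFinM mulfV// mul1e.
by move=> h; rewrite EFinD EFinM h addeC subeK.
Qed.

Lemma LI_taun_cvg psi : cont_ab psi -> LI (taun n) x psi @[n --> \oo] --> LI tau x psi.
Proof.
move=> cpsi; have [C C0 psiC] := bounded_comp_clip ab cpsi.
have -> : (fun n => LI (taun n) x psi) =
    fine \o (fun n => \int[(P \x mu)%E]_z (kern (taun n) x psi z)%:E)%E by [].
apply: fine_cvg; rewrite -LI_E//.
apply: (@dominated_cvg _ _ R (P \x mu)%E setT measurableT
    (fun n z => (kern (taun n) x psi z)%:E) (fun z => (kern tau x psi z)%:E)
    (fun z => (C / (2 * r) * exponential_pdf (2 * r) z.2)%:E)) => //.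
- move=> n; apply/measurable_EFinP.
  by apply: (@measurable_kern _ _ _ P) => //; exact: measurable_taun.
- move=> [w u] _; apply: cvg_near_cst; near=> n.
  rewrite /kern; congr (if _ then _ else _)%:E; rewrite /running /=; congr andb.
  rewrite /taun (tcutE stau)// le_min lee_fin.
  have -> : u <= n%:R by near: n; exact: nbhs_infty_ger.
  by rewrite andbT.
- exact: integrable_discount.
- move=> n z _; rewrite /= lee_fin.
  by apply: kern_bound.
Unshelve. all: by end_near.
Qed.

Lemma TI_Ycut_cvg psi : cont_ab psi ->
  (\int[P]_w (Ycut tau x psi n w)%:E @[n --> \oo] --> (TI tau x psi)%:E)%E.
Proof.
move=> cpsi; have [C C0 psiC] := bounded_comp_clip ab cpsi.
rewrite -TI_E//; apply: (@dominated_cvg _ _ R P setT measurableT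
  (fun n w => (Ycut tau x psi n w)%:E) _ (cst C%:E)) => //.
- by move=> n; apply/measurable_EFinP; by apply: (measurable_Ycut _ _ BM ab).
- move=> w _; apply: cvg_EFin; first exact: nearW.
  by apply: Ycut_cvg => //; exact: stau.
- exact: finite_measure_integrable_cst.
- by move=> n w _; rewrite /= lee_fin; by apply: Ycut_bound => //; exact: stau.
Qed.

Theorem Dynkin_powR p : TI tau x (fun y => y `^ p) =
  x `^ p + lam p * LI tau x (fun y => y `^ p).
Proof.
have cp := @within_continuous_powR R a b p a0.
have h1 := TI_Ycut_cvg cp.
have h2 : (\int[P]_w (Ycut tau x (fun y => y `^ p) n w)%:E @[n --> \oo] -->
    (x `^ p + lam p * LI tau x (fun y => y `^ p))%:E)%E.
  under eq_cvg do rewrite Dynkin_taun.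
  apply: cvg_EFin; first exact: nearW.
  apply: cvgD; first exact: cvg_cst.
  by apply: cvgM; [exact: cvg_cst|exact: LI_taun_cvg].
by apply: EFin_inj; apply: cvg_unique h1 h2.
Qed.

(** If the integral were 0, Tonelli would give a path with zero time integral, although its kernel
    is positive on an interval [0, m[. Strict positivity is asked only before [tau], because the
    weights of interest may vanish on the boundary. *)
Lemma LI_gt0 (psi : R -> R) : cont_ab psi -> (forall w, 0 < tau w)%E ->
  (forall w u, 0 <= u -> (u%:E <= tau w)%E -> 0 <= psi (Sp x u w)) ->
  (forall w u, 0 <= u -> (u%:E < tau w)%E -> 0 < psi (Sp x u w)) ->
  0 < LI tau x psi.
Proof.
move=> cpsi tau_gt0 psi0 psi_gt0.
have k0 z : (0 <= (kern tau x psi z)%:E)%E.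
  rewrite lee_fin /kern; case: ifP => // /andP[z0 zt].
  by rewrite mulr_ge0 ?expR_ge0// clip_id ?psi0//; exact: (good_in BM axb gtau).
have mk : measurable_fun setT (EFin \o kern tau x psi).
  by apply/measurable_EFinP; by apply: (@measurable_kern _ _ _ P).
rewrite lt_neqAle; apply/andP; split; last first.
  by rewrite -lee_fin -LI_E//; exact: integral_ge0.
apply/eqP => L0.
have : (\int[(P \x mu)%E]_z (kern tau x psi z)%:E)%E = 0%E by rewrite LI_E// -L0.
rewrite (@fubini_tonelli1 _ _ _ _ _ P mu (EFin \o kern tau x psi) mk k0).
set F := fubini_F _ _ => F0.
have Fge0 w : (0 <= F w)%E by apply: integral_ge0 => u _; exact: k0.
have mF : measurable_fun setT F by exact: measurable_fun_fubini_tonelli_F.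
have [w Fw] : exists w, F w = 0%E.
  have : ae_eq P setT F (cst 0%E).
    apply/(ae_eq_integral_abs _ _ mF) => //.
    by under eq_integral do rewrite gee0_abs//.
  move=> [N [mN N0 FN]]; apply: contrapT => /forallNP nF.
  have : P setT = 0%E.
    apply/eqP; rewrite eq_le measure_ge0 andbT -N0; apply: le_measure.
    - by rewrite inE; exact: measurableT.
    - by rewrite inE.
    - by move=> w _; apply: FN => /= /(_ I); exact: nF.
  have P1 : P setT = 1%E := @probability_setT _ _ _ P.
  by rewrite P1 => -[h]; have := oner_neq0 R; rewrite h eqxx.
have [m m0 mtau'] : exists2 m : R, 0 < m & (m%:E <= tau w)%E.
  have := tau_gt0 w; case: (tau w) => [t||]// t0; first by exists t.
  by exists 1; rewrite ?leey.
have mkw : measurable_fun setT (fun u => (kern tau x psi (w, u))%:E).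
  apply: (@measurableT_comp _ _ _ _ _ _ (EFin \o kern tau x psi) _ (fun u => (w, u))) => //.
  exact: measurable_fun_pair.
have : ae_eq mu setT (fun u => (kern tau x psi (w, u))%:E) (cst 0%E).
  refine ((@ae_eq_integral_abs _ _ R mu setT measurableT _ mkw).1 _).
  under eq_integral do rewrite gee0_abs//.
  exact: Fw.
move=> [N [mN N0 kN]].
have : (mu `[0%R, m[%classic <= mu N)%E.
  apply: le_measure; rewrite ?inE// => u; rewrite /= in_itv/= => /andP[u0 um].
  have ut : (u%:E < tau w)%E by rewrite (lt_le_trans _ mtau')// lte_fin.
  have : 0 < kern tau x psi (w, u).
    rewrite /kern /running /= u0 (ltW ut)/= mulr_gt0 ?expR_gt0// clip_id; first exact: psi_gt0.
    by apply: (good_in BM axb gtau) => //; exact: ltW.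
  move=> kgt0; apply: kN => /= h; have ku := EFin_inj (h I).
  by rewrite ku ltxx in kgt0.
rewrite N0 lebesgue_measure_itv/= lte_fin m0 oppr0 adde0 lee_fin.
by rewrite leNgt m0.
Qed.

End dynkin_formula.

(** * Everywhere measurable versions of admissible times *)

Section regularisation.
Context {d} {T : measurableType d} {R : realType}.
Variables (P : probability T R) (W : R -> T -> R) (r sig a b : R).
Hypothesis BM : is_std_BM P W.

(* An admissible time is only measurable up to [P]-negligible sets. *)
Lemma Tadm_good tau x : Tadm P W r sig a b x tau ->
  exists tau' N, [/\ good P W r sig a b tau' x, measurable N, P N = 0%E &
    forall w, ~ N w -> tau' w = tau w].
Proof.
move=> [[tau0 stau] [N0 [mN0 PN0 tauN0]]].
(* For each rational q >= 0 the event tau <= q agrees with a measurable set [BN.1] off a null set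
   [BN.2]; right-continuity allows any later time, here q + 1. Rationals suffice, since tau <= t
   means tau <= q for all rational q > t. *)
have /choice[BN BNP] : forall q : rat, exists BN : set T * set T,
    0 <= ratr q :> R ->
    [/\ measurable BN.1, measurable BN.2, P BN.2 = 0%E &
       forall w, ~ BN.2 w -> ((tau w <= (ratr q)%:E)%E <-> BN.1 w)].
  move=> q; have [q0|] := leP 0 (ratr q : R); last by exists (set0, set0).
  have := stau _ q0 (ratr q + 1); rewrite ltrDl ltr01 => /(_ isT).
  move=> /generated_up_to_negligible[A' GA' [N [mN PN AN]]].
  exists (A', N) => _ /=; split => //; first exact: (raw_gen_measurable BM GA').
  move=> w Nw; split => h; apply: contrapT => h'; apply: Nw; apply: AN.
    by left.
  by right.
pose FN k : set T := if @unpickle rat k is Some q then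
   (if 0 <= ratr q :> R then (BN q).2 else set0) else set0.
have FNP k : measurable (FN k) /\ P (FN k) = 0%E.
  rewrite /FN; case: unpickle => [q|]; last by split; [exact: measurable0|exact: measure0].
  case: ifPn => [/BNP[]//|_]; by split; [exact: measurable0|exact: measure0].
pose N := N0 `|` \bigcup_k FN k.
have mU : measurable (\bigcup_k FN k).
  by apply: bigcupT_measurable => k; exact: (FNP k).1.
have mN : measurable N by exact: measurableU.
have PN : P N = 0%E.
  apply/negligibleP => //; apply: negligibleU; first exact/negligibleP.
  apply: negligible_bigcup => k; apply/negligibleP; first exact: (FNP k).1.
  exact: (FNP k).2.
have NBN q w : 0 <= ratr q :> R -> ~ N w -> ~ (BN q).2 w.
  move=> q0 nN Bw; apply: nN; right; exists (pickle q); first exact: I.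
  rewrite /FN pickleK q0; exact: Bw.
(* The value 0 respects the exit bound, and changing [tau] on a null set preserves stopping because
   the filtration is augmented. *)
pose tau' w : \bar R := if w \in N then 0%E else tau w.
have tau'N w : ~ N w -> tau' w = tau w.
  by move=> Nw; rewrite /tau' memNset.
have tau'_ge0 w : (0 <= tau' w)%E by rewrite /tau'; case: ifP.
have mtau' : measurable_fun setT tau'.
  apply: measurable_nonneg_time => // t t0.
  rewrite (_ : [set w | _] = N `|` \bigcap_(k : nat) (if @unpickle rat k is Some q then
      (if t < ratr q :> R then (BN q).1 else setT) else setT)); last first.
    apply/seteqP; split => w /=.
      have [Nw _|Nw] := pselect (N w); first by left.
      rewrite tau'N// => tw; right => k _; case: unpickle => // q; case: ifPn => // tq.
      have q0 : 0 <= ratr q :> R by rewrite (le_trans t0)// ltW.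
      have [_ _ _ h] := BNP q q0.
      by apply/(h w (NBN _ _ q0 Nw)); rewrite (le_trans tw)// lee_fin ltW.
    have [Nw _|Nw] := pselect (N w); first by rewrite /tau' mem_set// lee_fin.
    move=> [//|H]; rewrite tau'N// leNgt; apply/negP => tw.
    have [m tm mw] : exists2 m : R, t < m & (m%:E <= tau w)%E.
      move: tw; case: (tau w) => [s||//]; first by rewrite lte_fin; exists s.
      by move=> _; exists (t + 1); rewrite ?leey ?ltrDl.
    have [q] := rat_in_itvoo tm; rewrite in_itv/= => /andP[tq qm].
    have q0 : 0 <= ratr q :> R by rewrite (le_trans t0)// ltW.
    have [_ _ _ h] := BNP q q0.
    have := H (pickle q) I; rewrite pickleK tq => /(h w (NBN _ _ q0 Nw)).
    by move=> /(le_trans mw); rewrite lee_fin leNgt qm.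
  apply: measurableU => //; apply: bigcapT_measurable => k.
  case: unpickle => [q|]//; case: ifPn => // tq.
  by have [] := BNP q (le_trans t0 (ltW tq)).
exists tau', N; split => //; split => //.
- split => // t t0 u tu.
  rewrite (_ : [set w | _] = N `|` ([set w | (tau w <= t%:E)%E] `&` ~` N)).
    have GN : <<s raw_gen W u `|` P.-negligible >> N.
      by apply: sub_sigma_algebra; right; exact/negligibleP.
    apply: gen_setU => //; apply: gen_setI; last exact: gen_setC.
    exact: stau.
  apply/seteqP; split => w /=.
    by have [Nw _|Nw] := pselect (N w); [left|rewrite tau'N// => ?; right].
  move=> [Nw|[tw Nw]]; last by rewrite tau'N.
  by rewrite /tau' mem_set// lee_fin.
- move=> w; have [Nw|Nw] := pselect (N w).
    by rewrite /tau' mem_set// exit_ge0.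
  rewrite tau'N//; apply: contrapT => h; apply: Nw; left; exact: tauN0.
Qed.
End regularisation.

(** * Touching lines *)

Section touching.
Context {R : realType} (F G : R -> R) (a b x : R).
Hypotheses (axb : a < x < b)
  (Fincr : forall y z, a <= y -> y < z -> z <= b -> F y < F z)
  (cF : {within `[a, b], continuous F}) (cG : {within `[a, b], continuous G}).

Lemma lipschitz_continuous (f : R -> R) (k : R) :
  (forall s t, f s <= f t + k * `|s - t|) -> continuous f.
Proof.
move=> lip s; apply/cvgrPdist_le => e e0.
have k1 : 0 < `|k| + 1 by rewrite ltr_wpDl.
near=> t; have st : `|s - t| <= e / (`|k| + 1).
  by near: t; apply: (@cvgr_dist_le _ _ _ (nbhs s) _ id s) => //; rewrite divr_gt0.
have kst : k * `|s - t| <= e.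
  apply: (@le_trans _ _ ((`|k| + 1) * `|s - t|)).
    by rewrite ler_wpM2r// (le_trans (ler_norm _))// lerDl.
  by rewrite mulrC -ler_pdivlMr.
rewrite ler_norml; apply/andP; split.
  by have := lip t s; rewrite distrC; lra.
by have := lip s t; lra.
Unshelve. all: by end_near.
Qed.

(* For each slope [s], lower the line of slope [s] (in the scale [F]) until it
   touches [G] to the right, resp. to the left of [x]; the two values at [x]
   are continuous in [s] and cross. *)
Lemma touching_line : exists c s l u,
  [/\ a <= l <= x, x <= u <= b,
      forall y, a <= y <= b -> G y <= c + s * (F y - F x),
      G l = c + s * (F l - F x) & G u = c + s * (F u - F x)].
Proof.
have /andP[ax xb] := axb.
have ab : a < b by exact: lt_trans xb.
pose f s y := G y - s * (F y - F x).
have cf s l u : a <= l -> u <= b -> {within `[l, u], continuous (f s)}.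
  move=> al ub; have sub : `[l, u] `<=` `[a, b].
    by move=> y; rewrite /= !in_itv/= => /andP[ly yu]; rewrite (le_trans al)//= (le_trans yu).
  have cf : {within `[a, b], continuous (f s)}.
    move=> y; apply: cvgB; first exact: cG.
    apply: cvgM; first exact: cvg_cst.
    by apply: cvgB; [exact: cF|exact: cvg_cst].
  exact: continuous_subspaceW sub cf.
have /choice[us usP] : forall s, exists u, u \in `[x, b] /\
    forall t, t \in `[x, b] -> f s t <= f s u.
  by move=> s; have [u ? ?] := EVT_max (ltW xb) (cf s _ _ (ltW ax) (lexx b)); exists u.
have /choice[ls lsP] : forall s, exists u, u \in `[a, x] /\
    forall t, t \in `[a, x] -> f s t <= f s u.
  by move=> s; have [u ? ?] := EVT_max (ltW ax) (cf s _ _ (lexx a) (ltW xb)); exists u.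
have [m _ mP] := EVT_max (ltW ab) cG.
have Fle y z : a <= y -> y <= z -> z <= b -> F y <= F z.
  by move=> ay; rewrite le_eqVlt => /predU1P[->//|yz zb]; exact/ltW/Fincr.
have Fbnd y : y \in `[a, b] -> `|F y - F x| <= F b - F a.
  rewrite in_itv/= => /andP[ay yb].
  have := Fle a y (lexx a) ay yb; have := Fle y b ay yb (lexx b).
  have := Fle a x (lexx a) (ltW ax) (ltW xb); have := Fle x b (ltW ax) (ltW xb) (lexx b).
  rewrite ler_norml; lra.
(* A maximum of functions of [s] that are all Lipschitz with constant F b - F a is Lipschitz with
   the same constant, even though the maximiser may jump. *)
have lip (us' : R -> R) (i : interval R) : (forall s, us' s \in i) -> {subset i <= `[a, b]} ->
    (forall s t, t \in i -> f s t <= f s (us' s)) -> continuous (fun s => f s (us' s)).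
  move=> usi iab usm; apply: (@lipschitz_continuous _ (F b - F a)) => s t.
  apply: (@le_trans _ _ (f t (us' s) + (F b - F a) * `|s - t|)); last first.
    by rewrite lerD2r usm.
  have -> : f s (us' s) = f t (us' s) + (t - s) * (F (us' s) - F x) by rewrite /f; ring.
  rewrite lerD2l (le_trans (ler_norm _))// normrM distrC mulrC ler_wpM2r//.
  by apply: Fbnd; exact: iab.
pose D s := f s (us s) - f s (ls s).
have cD : continuous D.
  move=> s; apply: cvgB.
    apply: (lip us `[x, b]) => [t|t|t u]; [exact: (usP t).1| |exact: (usP t).2].
    by rewrite !in_itv/= => /andP[xt ->]; rewrite (le_trans (ltW ax)).
  apply: (lip ls `[a, x]) => [t|t|t u]; [exact: (lsP t).1| |exact: (lsP t).2].
  by rewrite !in_itv/= => /andP[-> tx]; rewrite (le_trans tx)// ltW.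
have Fax : 0 < F x - F a by rewrite subr_gt0 Fincr// ltW.
have Fxb : 0 < F b - F x by rewrite subr_gt0 Fincr// ltW.
have Gma : G a <= G m by apply: mP; rewrite in_itv/= lexx ltW.
have Gmb : G b <= G m by apply: mP; rewrite in_itv/= lexx ltW.
(* Slope [s1] lifts the value of [f s1] at [a] to the maximum [G m], which no point right of [x]
   exceeds; [s0] does the same at [b] for the points left of [x]. So [D] changes sign. *)
pose s1 := (G m - G a) / (F x - F a).
pose s0 := - ((G m - G b) / (F b - F x)).
have s10 : 0 <= s1 by rewrite divr_ge0 ?(ltW Fax)// subr_ge0.
have s00 : s0 <= 0 by rewrite oppr_le0 divr_ge0 ?(ltW Fxb)// subr_ge0.
have D1 : D s1 <= 0.
  have h1 : f s1 (us s1) <= G m.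
    have := (usP s1).1; rewrite in_itv/= => /andP[xu ub].
    have := mP (us s1); rewrite in_itv/= (le_trans (ltW ax) xu) ub => /(_ isT).
    have : 0 <= s1 * (F (us s1) - F x) by rewrite mulr_ge0// subr_ge0 Fle// ltW.
    rewrite /f; lra.
  have := (lsP s1).2 a; rewrite in_itv/= lexx ltW// => /(_ isT).
  have -> : f s1 a = G m by rewrite /f /s1; field; exact: lt0r_neq0.
  rewrite /D; lra.
have D0 : 0 <= D s0.
  have h1 : f s0 (ls s0) <= G m.
    have := (lsP s0).1; rewrite in_itv/= => /andP[al lx].
    have := mP (ls s0); rewrite in_itv/= al (le_trans lx (ltW xb)) => /(_ isT).
    have : 0 <= s0 * (F (ls s0) - F x).
      by rewrite mulr_le0// subr_le0 Fle// ltW.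
    rewrite /f; lra.
  have := (usP s0).2 b; rewrite in_itv/= lexx ltW// => /(_ isT).
  have -> : f s0 b = G m by rewrite /f /s0; field; exact: lt0r_neq0.
  rewrite /D; lra.
have s01 : s0 <= s1 by exact: le_trans s10.
have [|s _ Ds] := @IVT _ D s0 s1 0 s01 (continuous_subspaceT cD).
  by rewrite ge_min le_max D0 D1 orbT.
have [ui um] := usP s; have [li lm] := lsP s.
move: Ds => /eqP; rewrite subr_eq0 => /eqP Ds.
exists (f s (us s)), s, (ls s), (us s); split.
- by rewrite in_itv/= in li.
- by rewrite in_itv/= in ui.
- move=> y /andP[ay yb]; rewrite -lerBlDr; have [xy|yx] := leP x y.
    by apply: um; rewrite in_itv/= xy.
  by rewrite Ds; apply: lm; rewrite in_itv/= ay ltW.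
- by rewrite Ds subrK.
- by rewrite subrK.
Qed.
End touching.

Lemma last_zero_before {R : realType} (q : R -> R) (l x : R) : l < x ->
  continuous q -> (forall y, l <= y <= x -> 0 <= q y) -> q l = 0 -> 0 < q x ->
  exists l', [/\ l <= l', l' < x, q l' = 0 & forall y, l' < y <= x -> 0 < q y].
Proof.
move=> lx cq q0 ql qx.
pose A := [set y | l <= y <= x /\ q y = 0].
have cA : closed A.
  rewrite (_ : A = `[l, x]%classic `&` q @^-1` [set 0]).
    apply: closedI; first exact: itv_closed.
    by apply: preimage_closed => //; exact: closed_eq.
  by apply/seteqP; split => y; rewrite /A /= in_itv/=.
have Al : A l by split; rewrite ?lexx ?ltW.
have Aub : ubound A x by move=> y [/andP[]].
have supA : has_sup A by split; [exists l|exists x].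
have [/andP[ls sx] qs] : A (sup A).
  rewrite {1}((closure_id A).1 cA); apply: closure_sup; [by exists l|by exists x].
exists (sup A); split => //.
  rewrite lt_neqAle sx andbT; apply/eqP => e; move: qs; rewrite e => /eqP.
  by rewrite gt_eqF.
move=> y /andP[sy yx]; rewrite lt_neqAle q0 ?yx ?(le_trans ls (ltW sy))// andbT.
apply/eqP => qy; have : y <= sup A.
  apply: sup_upper_bound => //; split => //.
  by rewrite yx (le_trans ls (ltW sy)).
by rewrite leNgt sy.
Qed.

(** Further zeros of [q] may lie between [l] and [u]; the nearest ones on either side of [x] are
    taken, the right one by reflection. *)
Lemma positive_component {R : realType} (q : R -> R) (l x u : R) : l < x -> x < u ->
  continuous q -> (forall y, l <= y <= u -> 0 <= q y) -> q l = 0 -> q u = 0 -> 0 < q x ->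
  exists l' u', [/\ l <= l', l' < x, x < u', u' <= u &
    [/\ q l' = 0, q u' = 0 & forall y, l' < y < u' -> 0 < q y]].
Proof.
move=> lx xu cq q0 ql qu qx.
have [|l' [ll' l'x ql' hl]] := last_zero_before lx cq _ ql qx.
  by move=> y /andP[ly yx]; apply: q0; rewrite ly (le_trans yx)// ltW.
have cq' : continuous (q \o -%R).
  move=> y; apply: (cvg_comp _ _ (_ : -%R z @[z --> y] --> - y) (cq (- y))).
  by apply: cvgN; exact: cvg_id.
have := @last_zero_before _ (q \o -%R) (- u) (- x).
rewrite ltrN2 /= !opprK => /(_ xu cq').
case=> [y /andP[uy yx]|//|//|u' [uu' u'x qu' hu]].
  by apply: q0; rewrite lerNl in uy; rewrite lerNr in yx; rewrite uy (le_trans (ltW lx)).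
exists l', (- u'); split => //; rewrite 1?ltrNr 1?lerNl//.
split => // y /andP[ly yu]; have [yx|xy] := leP y x; first by apply: hl; rewrite ly.
by rewrite -[y]opprK; apply: hu; rewrite lerN2 (ltW xy) andbT ltrNr.
Qed.

(** * Potentials and harmonic functions *)

Section put_price.
Context {R : realType}.
Variables (r sig K : R).
Hypotheses (r0 : 0 < r) (sig0 : 0 < sig) (K0 : 0 < K).

Lemma dd_gt0 : 0 < dd r sig.
Proof. by rewrite divr_gt0 ?mulr_gt0 ?exprn_gt0. Qed.

Lemma ahat_gt0 : 0 < ahat r sig K.
Proof. by rewrite divr_gt0// addr_gt0// divr_gt0// dd_gt0. Qed.

Lemma PpE y : ahat r sig K <= y ->
  Pp r sig K y = - (ahat r sig K / y) `^ (1 + dd r sig).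
Proof.
move=> ay; have y0 : 0 < y by exact: lt_le_trans ahat_gt0 ay.
apply/max_l; rewrite lerN2 (@le_trans _ _ (1 `^ (1 + dd r sig)))//; last by rewrite powR1.
apply: ge0_ler_powR.
- by rewrite addr_ge0// ltW// dd_gt0.
- by rewrite nnegrE divr_ge0 ?(ltW ahat_gt0) ?(ltW y0).
- by rewrite nnegrE.
- by rewrite ler_pdivrMr// mul1r.
Qed.

Lemma Pp_powR y : ahat r sig K <= y -> Pp r sig K y =
  - ahat r sig K `^ (1 + dd r sig) * y `^ (- (1 + dd r sig)).
Proof.
move=> ay; have y0 : 0 < y by exact: lt_le_trans ahat_gt0 ay.
rewrite PpE// powRM ?invr_ge0 ?(ltW y0) ?(ltW ahat_gt0)// mulNr.
by rewrite -powR_inv1 ?(ltW y0)// -powRrM mulN1r.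
Qed.

Lemma Pp_incr y z : ahat r sig K <= y -> y < z -> Pp r sig K y < Pp r sig K z.
Proof.
move=> ay yz; have y0 : 0 < y by exact: lt_le_trans ahat_gt0 ay.
have z0 : 0 < z by exact: lt_trans yz.
rewrite !PpE ?(le_trans ay (ltW yz))// ltrN2; apply: gt0_ltr_powR.
- by rewrite addr_gt0// dd_gt0.
- by rewrite nnegrE divr_ge0 ?(ltW ahat_gt0) ?(ltW z0).
- by rewrite nnegrE divr_ge0 ?(ltW ahat_gt0) ?(ltW y0).
- by rewrite ltr_pM2l ?ahat_gt0// ltf_pV2.
Qed.

Lemma lamE p : lam r sig p = sig ^+ 2 / 2 * (p ^+ 2 + (dd r sig - 1) * p - 2 * dd r sig).
Proof. rewrite /lam /dd; field; exact: lt0r_neq0. Qed.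

(** The exponents of the two fundamental power solutions of (L - 2r) v = 0. They are distinct
    because the discriminant (d - 1)^2 + 8 d is positive. *)
Lemma lam_roots : exists k1 k2, [/\ k1 < k2, lam r sig k1 = 0 & lam r sig k2 = 0].
Proof.
have d0 := dd_gt0.
pose D := (dd r sig - 1) ^+ 2 + 8 * dd r sig.
have D0 : 0 < D by rewrite ltr_wpDl ?sqr_ge0// mulr_gt0.
have sD : Num.sqrt D ^+ 2 = D by rewrite sqr_sqrtr// ltW.
exists ((1 - dd r sig - Num.sqrt D) / 2), ((1 - dd r sig + Num.sqrt D) / 2); split.
- by rewrite ltr_pM2r// ltrD2l gtrN// sqrtr_gt0.
- rewrite lamE (_ : _ + _ - _ = (Num.sqrt D ^+ 2 - D) / 4); last by rewrite /D; field.
  by rewrite sD subrr mul0r mulr0.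
- rewrite lamE (_ : _ + _ - _ = (Num.sqrt D ^+ 2 - D) / 4); last by rewrite /D; field.
  by rewrite sD subrr mul0r mulr0.
Qed.

(** These are the exponents of the three running weights. A nonzero eigenvalue makes a multiple of
    the weight itself a particular solution. *)
Lemma lam_neq0 : [/\ lam r sig 2 != 0, lam r sig (1 - dd r sig) != 0 &
  lam r sig (- (2 * dd r sig)) != 0].
Proof.
have d0 := dd_gt0; have s0 : sig ^+ 2 / 2 != 0 by rewrite lt0r_neq0// divr_gt0// exprn_gt0.
rewrite !lamE; split; rewrite mulf_neq0//.
- by rewrite (_ : _ - _ = 2) //; ring.
- by rewrite (_ : _ - _ = - (2 * dd r sig)); [rewrite oppr_eq0 lt0r_neq0// mulr_gt0|ring].
- by rewrite (_ : _ - _ = 2 * dd r sig ^+ 2); [rewrite lt0r_neq0// mulr_gt0// exprn_gt0|ring].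
Qed.

End put_price.

Section potentials.
Context {d} {T : measurableType d} {R : realType}.
Variables (P : probability T R) (W : R -> T -> R) (r sig a b : R).
Hypotheses (BM : is_std_BM P W) (r0 : 0 < r) (a0 : 0 < a) (ab : a < b).
Local Notation good := (good P W r sig a b).
Local Notation LI := (LI P W r sig a b).
Local Notation TI := (TI P W r sig a b).
Local Notation cont_ab psi := {within `[a, b], continuous psi}.
Local Notation exit := (tauI W r sig).
Implicit Types (psi e Gam : R -> R) (tau : T -> \bar R).

Lemma good_exit l u x : a <= l -> u <= b -> good (exit l u x) x.
Proof.
move=> al ub; split; first exact: (measurable_exit _ _ BM).
  exact: (exit_stopping _ _ BM).
by move=> w; exact: exit_mono.
Qed.

Lemma cont_lin (k : R) psi1 psi2 : cont_ab psi1 -> cont_ab psi2 ->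
  cont_ab (fun y => k * psi1 y + psi2 y).
Proof.
move=> c1 c2 y; apply: cvgD; last exact: c2.
by apply: cvgM; [exact: cvg_cst|exact: c1].
Qed.

Lemma cont_scale (k : R) psi : cont_ab psi -> cont_ab (fun y => k * psi y).
Proof. by move=> c1 y; apply: cvgM; [exact: cvg_cst|exact: c1]. Qed.

Let cont0 : cont_ab (cst 0 : R -> R).
Proof. by move=> y; exact: cvg_cst. Qed.

Lemma TI_scale tau x (k : R) psi : good tau x -> cont_ab psi ->
  TI tau x (fun y => k * psi y) = k * TI tau x psi.
Proof.
move=> [mt st _] c.
have T0 : TI tau x (cst 0) = 0.
  have : TI tau x (fun y => 1 * (cst 0 : R -> R) y + (cst 0 : R -> R) y) = TI tau x (cst 0).
    by apply: TI_ext => // y _; rewrite /= mul1r addr0.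
  rewrite TI_linear//; lra.
have : TI tau x (fun y => k * psi y + (cst 0 : R -> R) y) = TI tau x (fun y => k * psi y).
  by apply: TI_ext => // y _; rewrite addr0.
by move=> <-; rewrite TI_linear// T0 addr0.
Qed.

Lemma LI_scale tau x (k : R) psi : good tau x -> cont_ab psi ->
  LI tau x (fun y => k * psi y) = k * LI tau x psi.
Proof.
move=> [mt _ _] c.
have L0 : LI tau x (cst 0) = 0.
  have : LI tau x (fun y => 1 * (cst 0 : R -> R) y + (cst 0 : R -> R) y) = LI tau x (cst 0).
    by apply: LI_ext => // y _; rewrite /= mul1r addr0.
  rewrite LI_linear//; lra.
have : LI tau x (fun y => k * psi y + (cst 0 : R -> R) y) = LI tau x (fun y => k * psi y).
  by apply: LI_ext => // y _; rewrite addr0.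
by move=> <-; rewrite LI_linear// L0 addr0.
Qed.

(** Integrated form of (L - 2r) Gam = -e with zero boundary values: Dynkin's formula at every good
    time stands in for the differential equation. *)
Definition potential e Gam := [/\ cont_ab Gam, Gam a = 0, Gam b = 0 &
  forall x tau, a <= x <= b -> good tau x -> LI tau x e = Gam x - TI tau x Gam].

(** At a finite exit time the path is at [l] or [u], and an infinite one contributes 0 to both
    sides. *)
Lemma TI_exit_ext l u x psi1 psi2 : a <= l -> u <= b -> l <= x <= u ->
  psi1 l = psi2 l -> psi1 u = psi2 u ->
  TI (exit l u x) x psi1 = TI (exit l u x) x psi2.
Proof.
move=> al ub lxu e1 e2; rewrite /TI; congr fine; apply: eq_integral => w _.
rewrite /tdisc; case E: (exit l u x w) => [t| |]//.
have t0 : 0 <= t by rewrite -lee_fin -E exit_ge0.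
have /andP[lx xu] := lxu; have lu := le_trans lx xu.
have [h|h] := exit_boundary BM lxu E; rewrite (S_Spos _ _ _ _ _ t0) in h; rewrite h clip_id.
- by rewrite e1.
- by rewrite al (le_trans lu).
- by rewrite e2.
- by rewrite ub (le_trans al).
Qed.

Lemma potentialE e Gam x : potential e Gam -> a <= x <= b ->
  Gam x = LI (exit a b x) x e.
Proof.
move=> [cG Ga Gb GL] axb; rewrite GL//; last exact: good_exit.
rewrite (@TI_exit_ext _ _ _ Gam (fun y => 0 * Gam y))//; last 2 first.
- by rewrite mul0r.
- by rewrite mul0r.
by rewrite TI_scale//; [rewrite mul0r subr0|exact: good_exit].
Qed.

Lemma potential_ext e e' Gam : (forall y, a <= y <= b -> e y = e' y) ->
  potential e Gam -> potential e' Gam.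
Proof.
move=> ee [cG Ga Gb GL]; split => // x tau axb gt.
rewrite -GL//; apply: LI_ext => // y ayb; by rewrite ee.
Qed.

Section harmonic.
Variables (k1 k2 : R).
Hypotheses (k12 : k1 < k2) (lk1 : lam r sig k1 = 0) (lk2 : lam r sig k2 = 0).

Definition harm (al be y : R) := al * y `^ k1 + be * y `^ k2.

Lemma cont_harm al be : cont_ab (harm al be).
Proof.
apply: cont_lin; first exact: within_continuous_powR.
by apply: cont_scale; exact: within_continuous_powR.
Qed.

Lemma TI_harm al be tau x : a <= x <= b -> good tau x ->
  TI tau x (harm al be) = harm al be x.
Proof.
move=> axb gt; have [mt st _] := gt.
have c p := @within_continuous_powR R a b p a0.
rewrite TI_linear//; last exact: cont_scale.
rewrite TI_scale// !(Dynkin_powR BM r0 a0 ab axb gt) lk1 lk2.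
by rewrite !mul0r !addr0.
Qed.

Lemma powR_k2 y : 0 < y -> y `^ k2 = y `^ k1 * y `^ (k2 - k1).
Proof.
move=> y0; rewrite -powRD; first by rewrite addrC subrK.
by rewrite (gt_eqF y0) implybT.
Qed.

Lemma scale_incr y z : a <= y -> y < z -> y `^ (k2 - k1) < z `^ (k2 - k1).
Proof.
move=> ay yz; have y0 : 0 < y by exact: lt_le_trans ay.
apply: gt0_ltr_powR => //; first by rewrite subr_gt0.
  by rewrite nnegrE ltW.
by rewrite nnegrE ltW// (lt_trans y0).
Qed.

(** Divided by y^k1, the problem is two-point affine interpolation in y^(k2 - k1), solvable because
    this scale is strictly increasing. *)
Lemma harm_interpolation va vb : exists al be, harm al be a = va /\ harm al be b = vb.
Proof.
have b0 := lt_trans a0 ab.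
have F := scale_incr (lexx a) ab.
have pa : a `^ k1 != 0 by rewrite lt0r_neq0// powR_gt0.
have pb : b `^ k1 != 0 by rewrite lt0r_neq0// powR_gt0.
set Fa := a `^ (k2 - k1) in F; set Fb := b `^ (k2 - k1) in F.
have Fab : Fb - Fa != 0 by rewrite lt0r_neq0// subr_gt0.
pose be := (vb / b `^ k1 - va / a `^ k1) / (Fb - Fa).
exists (va / a `^ k1 - be * Fa), be.
rewrite /harm !powR_k2// -/Fa -/Fb /be; split; field; do ?[apply/andP; split]; done.
Qed.

(** The particular solution is -c y^p / lam p; a harmonic function that matches c y^p at both ends
    corrects its boundary values to 0. *)
Lemma potential_powR c p : lam r sig p != 0 ->
  exists Gam, potential (fun y => c * y `^ p) Gam.
Proof.
move=> lp; have cp := @within_continuous_powR R a b p a0.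
have [al [be [ha hb]]] := harm_interpolation (c * a `^ p) (c * b `^ p).
exists (fun y => (lam r sig p)^-1 * harm al be y + (- c / lam r sig p) * y `^ p); split.
- by apply: cont_lin; [exact: cont_harm|exact: cont_scale].
- by rewrite ha; field.
- by rewrite hb; field.
move=> x tau axb gt; have [mt st _] := gt.
rewrite TI_linear//; [|exact: cont_harm|exact: cont_scale].
rewrite TI_harm// TI_scale// (Dynkin_powR BM r0 a0 ab axb gt).
rewrite LI_scale//.
by field.
Qed.

End harmonic.
End potentials.

(** * The stopping problem *)

Lemma within_continuous_ext {R : realType} (a b : R) (f g : R -> R) :
  (forall y, a <= y <= b -> f y = g y) ->
  {within `[a, b], continuous f} -> {within `[a, b], continuous g}.
Proof.
move=> fg; apply: subspace_eq_continuous => y; rewrite inE/= in_itv/=.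
exact: fg.
Qed.

Section stopping_problem.
Context {d} {T : measurableType d} {R : realType}.
Variables (P : probability T R) (W : R -> T -> R) (r sig K a b : R).
Hypotheses (r0 : 0 < r) (sig0 : 0 < sig) (K0 : 0 < K) (Ka : ahat r sig K <= a)
  (ab : a < b) (BM : is_std_BM P W).
Local Notation good := (good P W r sig a b).
Local Notation LI := (LI P W r sig a b).
Local Notation TI := (TI P W r sig a b).
Local Notation cont_ab psi := {within `[a, b], continuous psi}.
Local Notation exit := (tauI W r sig).
Local Notation potential := (potential P W r sig a b).
Local Notation PP := (Pp r sig K).
Local Notation V := (Vfun P W r sig K a b).
Local Notation cost := (Cost P W r sig K a b).
Local Notation M := (Mfun P W r sig K a b).

Let a0 : 0 < a. Proof. exact: lt_le_trans (ahat_gt0 r0 sig0 K0) Ka. Qed.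

Definition wt1 (y : R) : R := sig ^+ 2 * y ^+ 2.
Definition wt2 (y : R) : R := PP y * sig ^+ 2 * y ^+ 2.
Definition wt3 (y : R) : R := PP y ^+ 2 * sig ^+ 2 * y ^+ 2.

(** On [a, b] one has P'(y) = -kap y^(-(1+d)), so each weight is a constant times a single power. *)
Let kap := ahat r sig K `^ (1 + dd r sig).

Lemma wt1E y : a <= y <= b -> sig ^+ 2 * y `^ 2 = wt1 y.
Proof.
by move=> /andP[ay _]; rewrite /wt1 powR_mulrn// (le_trans (ltW a0)).
Qed.

Lemma wt2E y : a <= y <= b -> - (kap * sig ^+ 2) * y `^ (1 - dd r sig) = wt2 y.
Proof.
move=> /andP[ay _]; have y0 : 0 < y by exact: lt_le_trans ay.
rewrite /wt2 (Pp_powR r0 sig0 K0 (le_trans Ka ay)) -/kap.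
have -> : 1 - dd r sig = - (1 + dd r sig) + 2%:R by ring.
rewrite powRD; last by rewrite (gt_eqF y0) implybT.
rewrite powR_mulrn ?(ltW y0)//; ring.
Qed.

Lemma wt3E y : a <= y <= b -> (kap ^+ 2 * sig ^+ 2) * y `^ (- (2 * dd r sig)) = wt3 y.
Proof.
move=> /andP[ay _]; have y0 : 0 < y by exact: lt_le_trans ay.
rewrite /wt3 (Pp_powR r0 sig0 K0 (le_trans Ka ay)) -/kap.
have -> : - (2 * dd r sig) = - (1 + dd r sig) + (- (1 + dd r sig) + 2%:R) by ring.
do 2 (rewrite powRD; last by rewrite (gt_eqF y0) implybT).
rewrite powR_mulrn ?(ltW y0)//; ring.
Qed.

Lemma cont_wt : [/\ cont_ab wt1, cont_ab wt2 & cont_ab wt3].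
Proof.
have c c' p : cont_ab (fun y => c' * y `^ p).
  by apply: cont_scale; exact: within_continuous_powR.
split.
- exact: (within_continuous_ext wt1E).
- exact: (within_continuous_ext wt2E).
- exact: (within_continuous_ext wt3E).
Qed.

Lemma potentials_exist : exists G1 G2 G3,
  [/\ potential wt1 G1, potential wt2 G2 & potential wt3 G3].
Proof.
have [k1 [k2 [k12 l1 l2]]] := lam_roots r0 sig0.
have [n1 n2 n3] := lam_neq0 r0 sig0.
have [G1 p1] := potential_powR BM r0 a0 ab k12 l1 l2 (sig ^+ 2) n1.
have [G2 p2] := potential_powR BM r0 a0 ab k12 l1 l2 (- (kap * sig ^+ 2)) n2.
have [G3 p3] := potential_powR BM r0 a0 ab k12 l1 l2 (kap ^+ 2 * sig ^+ 2) n3.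
exists G1, G2, G3; split.
- exact: (potential_ext ab wt1E p1).
- exact: (potential_ext ab wt2E p2).
- exact: (potential_ext ab wt3E p3).
Qed.

Lemma wt1_gt0 y : 0 < y -> 0 < wt1 y.
Proof. by move=> y0; rewrite mulr_gt0 ?exprn_gt0. Qed.

Lemma PP_incr y z : a <= y -> y < z -> PP y < PP z.
Proof. by move=> ay; apply: Pp_incr => //; exact: le_trans ay. Qed.

Lemma PP_le y z : a <= y -> y <= z -> PP y <= PP z.
Proof. by move=> ay; rewrite le_eqVlt => /predU1P[->//|/(PP_incr ay)/ltW]. Qed.

(** [wt2] is P' times [wt1], and P' lies strictly between its end values as long as the path is
    inside (a, b); equality can occur only at the exit. *)
Lemma LI_ratio tau x : a <= x <= b -> good tau x -> (forall w, 0 < tau w)%E ->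
  [/\ 0 < LI tau x wt1, PP a * LI tau x wt1 < LI tau x wt2 &
      LI tau x wt2 < PP b * LI tau x wt1].
Proof.
move=> axb gt tau_gt0; have [mt st le_tau] := gt; have [c1 c2 c3] := cont_wt.
have inS w u : 0 <= u -> (u%:E <= tau w)%E -> a <= Spos W r sig x u w <= b.
  exact: (good_in BM axb gt).
have inS' w u : 0 <= u -> (u%:E < tau w)%E -> a < Spos W r sig x u w < b.
  move=> u0 ut; have := @before_exit _ _ _ W r sig a b x w u u0.
  by rewrite S_Spos//; apply; exact: lt_le_trans ut (le_tau w).
split.
- apply: (LI_gt0 BM r0 ab axb gt) => //.
    by move=> w u u0 ut; rewrite ltW// wt1_gt0// Spos_gt0// (lt_le_trans a0)//; case/andP: axb.
  by move=> w u u0 ut; rewrite wt1_gt0// Spos_gt0// (lt_le_trans a0)//; case/andP: axb.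
- rewrite -subr_gt0 addrC -mulNr -LI_linear//.
  have E y : - PP a * wt1 y + wt2 y = (PP y - PP a) * wt1 y by rewrite /wt1 /wt2; ring.
  apply: (LI_gt0 BM r0 ab axb gt) => //; first exact: cont_lin.
    move=> w u u0 ut; have /andP[h1 h2] := inS w u u0 ut.
    by rewrite E mulr_ge0 ?subr_ge0 ?PP_le// ltW// wt1_gt0// (lt_le_trans a0).
  move=> w u u0 ut; have /andP[h1 h2] := inS' w u u0 ut.
  by rewrite E mulr_gt0 ?subr_gt0 ?PP_incr// wt1_gt0// (lt_trans a0).
- rewrite -subr_gt0.
  have -> : PP b * LI tau x wt1 - LI tau x wt2 = LI tau x (fun y => (-1) * wt2 y + PP b * wt1 y).
    rewrite LI_linear//; last exact: cont_scale.
    by rewrite LI_scale//; ring.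
  have E y : (-1) * wt2 y + PP b * wt1 y = (PP b - PP y) * wt1 y by rewrite /wt1 /wt2; ring.
  apply: (LI_gt0 BM r0 ab axb gt) => //; first by apply: cont_lin => //; exact: cont_scale.
    move=> w u u0 ut; have /andP[h1 h2] := inS w u u0 ut.
    by rewrite E mulr_ge0 ?subr_ge0 ?PP_le// ltW// wt1_gt0// (lt_le_trans a0).
  move=> w u u0 ut; have /andP[h1 h2] := inS' w u u0 ut.
  by rewrite E mulr_gt0 ?subr_gt0 ?PP_incr// ?wt1_gt0// ?(lt_trans a0)// ltW.
Qed.

Variables (G1 G2 G3 : R -> R).
Hypotheses (pot1 : potential wt1 G1) (pot2 : potential wt2 G2) (pot3 : potential wt3 G3).

Let gI x : good (exit a b x) x. Proof. exact: good_exit. Qed.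

Lemma gamE y : a <= y <= b ->
  [/\ gam1 P W r sig a b y = G1 y, gam2 P W r sig K a b y = G2 y &
      gam3 P W r sig K a b y = G3 y].
Proof.
move=> ayb; have [c1 c2 c3] := cont_wt.
rewrite (potentialE BM r0 ab pot1 ayb) (potentialE BM r0 ab pot2 ayb).
rewrite (potentialE BM r0 ab pot3 ayb).
have E psi : cont_ab psi ->
    fine (Expect P (run_int W r sig (exit a b y) y psi)) = LI (exit a b y) y psi.
  by move=> c; rewrite (Expect_run_int BM r0 ab ayb (gI y) c).
by split; apply: E.
Qed.

Lemma G_ratio y : a < y < b ->
  [/\ 0 < G1 y, PP a * G1 y < G2 y & G2 y < PP b * G1 y].
Proof.
move=> ayb; have ayb' : a <= y <= b by case/andP: ayb => /ltW -> /ltW ->.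
rewrite (potentialE BM r0 ab pot1 ayb') (potentialE BM r0 ab pot2 ayb').
by apply: LI_ratio => // w; apply: (@exit_gt0 _ _ _ P).
Qed.

(** [Qfun h y] is the cost of keeping [h] until the exit from (a, b). As a parabola in [h] it has
    minimum M(y) at G2 / G1, and [gapfun] is the excess over it. At [a] and [b], where G1 = 0, the
    inverse of 0 makes the value 0. *)
Definition gapfun (h y : R) : R := (h * G1 y - G2 y) ^+ 2 / G1 y.
Definition Qfun (h y : R) : R := h ^+ 2 * G1 y + (- (2 * h) * G2 y + G3 y).

Lemma Mfun_Q h y : a <= y <= b -> M y = Qfun h y - gapfun h y.
Proof.
move=> ayb; have [Ga1 Gb1 Ga2 Gb2] : [/\ G1 a = 0, G1 b = 0, G2 a = 0 & G2 b = 0].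
  by case: pot1 => _ -> -> _; case: pot2 => _ -> -> _.
have [Ga3 Gb3] : G3 a = 0 /\ G3 b = 0 by case: pot3.
rewrite /Mfun /Qfun /gapfun; case: ifPn => [ayb'|].
  have [g1 _ _] := G_ratio ayb'.
  have [-> -> ->] := gamE ayb.
  by field; exact: lt0r_neq0.
case/andP: ayb => ay yb; rewrite negb_and -!leNgt => /orP[h1|h1].
  have -> : y = a by apply/eqP; rewrite eq_le h1.
  by rewrite Ga1 Ga2 Ga3; ring.
have -> : y = b by apply/eqP; rewrite eq_le yb.
by rewrite Gb1 Gb2 Gb3; ring.
Qed.

Lemma gapfun_ge0 h y : a <= y <= b -> 0 <= gapfun h y.
Proof.
move=> /andP[ay yb]; apply: mulr_ge0; first exact: sqr_ge0.
rewrite invr_ge0; have [ya|yna] := eqVneq y a; first by case: pot1 => _ e _ _; rewrite ya e.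
have [yb'|ynb] := eqVneq y b; first by case: pot1 => _ _ e _; rewrite yb' e.
have [|/ltW->] := @G_ratio y; rewrite ?lt_neqAle ?(eq_sym a) ?yna ?ay ?ynb ?yb//.
Qed.

(** The issue is the quotient 0 / 0 at the endpoints. Since G2 / G1 lies between P'(a) and P'(b),
    [gapfun h] is at most a constant times G1, which tends to 0 there. *)
Lemma cont_gapfun h : cont_ab (gapfun h).
Proof.
have [cG1 Ga1 Gb1 _] := pot1; have [cG2 Ga2 Gb2 _] := pot2.
apply/subspace_continuousP => y; rewrite /= in_itv/= => ayb.
move/subspace_continuousP: (cG1) => /(_ y); rewrite /= in_itv/= => /(_ ayb) c1.
move/subspace_continuousP: (cG2) => /(_ y); rewrite /= in_itv/= => /(_ ayb) c2.
have [/G_ratio[g1 _ _]|nayb] := boolP (a < y < b).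
  apply: cvgM; last by apply: cvgV => //; exact: lt0r_neq0.
  apply: (@cvg_comp _ _ _ (fun y => h * G1 y - G2 y) (fun z => z ^+ 2)); last exact: exprn_continuous.
  by apply: cvgB => //; apply: cvgM => //; exact: cvg_cst.
have y1 : G1 y = 0.
  case/andP: ayb nayb => ay yb; rewrite negb_and -!leNgt => /orP[h1|h1].
    by have -> : y = a by apply/eqP; rewrite eq_le h1.
  by have -> : y = b by apply/eqP; rewrite eq_le yb.
have gy : gapfun h y = 0 by rewrite /gapfun y1 invr0 mulr0.
suff h0 : gapfun h z @[z --> within `[a, b] (nbhs y)] --> (0 : R).
  by rewrite -gy in h0; exact: h0.
pose C := (`|h| + `|PP a| + `|PP b|) ^+ 2.
have bnd z : a <= z <= b -> gapfun h z <= C * G1 z.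
  move=> azb; have [/G_ratio[g1 g2 g3]|nazb] := boolP (a < z < b).
    rewrite /gapfun ler_pdivrMr// -mulrA -expr2 /C -exprMn -[leLHS]ger0_norm ?sqr_ge0// normrX.
    rewrite lerXn2r ?nnegrE ?mulr_ge0 ?addr_ge0 ?(ltW g1)//.
    have h1 := ler_norm (PP b); have h2 := ler_norm (- PP a); rewrite normrN in h2.
    have h3 := ler_norm h; have h4 := ler_norm (- h); rewrite normrN in h4.
    have [p1 p2] : 0 <= `|PP a| /\ 0 <= `|PP b| by split; exact: normr_ge0.
    have p3 : 0 <= `|h| by exact: normr_ge0.
    rewrite ler_norml; apply/andP; split; nra.
  have z1 : G1 z = 0.
    case/andP: azb nazb => az zb; rewrite negb_and -!leNgt => /orP[h1|h1].
      by have -> : z = a by apply/eqP; rewrite eq_le h1.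
    by have -> : z = b by apply/eqP; rewrite eq_le zb.
  by rewrite /gapfun z1 invr0 !mulr0.
apply: (@squeeze_cvgr _ _ _ _ (cst 0) (fun z => C * G1 z)).
- apply: (@filterS _ (within `[a, b] (nbhs y)) _ `[a, b]%classic); last exact: withinT.
  by move=> z; rewrite /= in_itv/= => azb; rewrite gapfun_ge0//= bnd.
- exact: cvg_cst.
- have : C * G1 z @[z --> within `[a, b] (nbhs y)] --> C * G1 y.
    by apply: cvgM => //; exact: cvg_cst.
  by rewrite y1 mulr0.
Qed.

Lemma cont_Qfun h : cont_ab (Qfun h).
Proof.
by apply: cont_lin; [case: pot1|apply: cont_lin; [case: pot2|case: pot3]].
Qed.

Lemma cont_Mfun : cont_ab M.
Proof.
apply: (@within_continuous_ext _ _ _ (fun y => (-1) * gapfun 0 y + Qfun 0 y)).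
  by move=> y ayb; rewrite (Mfun_Q 0)//; ring.
by apply: cont_lin; [exact: cont_gapfun|exact: cont_Qfun].
Qed.

Lemma fcostE h y : fcost r sig K y h = h ^+ 2 * wt1 y + (- (2 * h) * wt2 y + wt3 y).
Proof. by rewrite /fcost /wt1 /wt2 /wt3; ring. Qed.

(** The form for comparing two hedges under one stopping time: the terminal term is free of [h]. *)
Lemma cost_quadratic tau x h : a <= x <= b -> good tau x ->
  cost x h tau = (h ^+ 2 * LI tau x wt1 - 2 * h * LI tau x wt2 + LI tau x wt3 +
                  TI tau x M)%:E.
Proof.
move=> axb gt; have [mt st le_tau] := gt; have [c1 c2 c3] := cont_wt.
have cf : cont_ab (fun y => fcost r sig K y h).
  apply: (@within_continuous_ext _ _ _ (fun y => h ^+ 2 * wt1 y + (- (2 * h) * wt2 y + wt3 y))).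
    by move=> y _; rewrite fcostE.
  by apply: cont_lin => //; exact: cont_lin.
have ik : (P \x lebesgue_measure)%E.-integrable setT
    (EFin \o kern W r sig a b tau x (fun y => fcost r sig K y h)) by exact: integrable_kern.
rewrite /Cost /Expect.
under eq_integral => w _.
  rewrite (@run_int_kern _ _ _ P _ _ _ a b)//.
  rewrite (_ : terminal P W r sig K a b tau x w = (tdisc W r sig a b tau x M w)%:E); last first.
    rewrite /terminal /tdisc; have := st.1 w; case E: (tau w) => [t| |] t0; [|by []|by []].
    have e : clip a b (Spos W r sig x t w) = S W r sig x t w.
      rewrite S_Spos//; apply: clip_id; apply: (good_in BM axb gt) => //.
      by rewrite E.
    by rewrite e.
  over.
rewrite integralD//; last 2 first.
- exact: (integrable_fubini_F ik).
- by apply: (@integrable_tdisc _ _ _ P W r sig a b) => //; exact: cont_Mfun.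
rewrite (@TI_E _ _ _ P W r sig a b BM r0 ab _ x _ mt st cont_Mfun).
have -> : (\int[P]_w \int[lebesgue_measure]_u
   (kern W r sig a b tau x (fun y => fcost r sig K y h) (w, u))%:E)%E =
   (LI tau x (fun y => fcost r sig K y h))%:E.
  by rewrite -LI_E// -(integral12_prod_meas1 ik).
rewrite -EFinD; congr (_ + _)%:E.
rewrite (@LI_ext _ _ _ _ _ _ _ _ _ ab _ _ _ (fun y => h ^+ 2 * wt1 y + (- (2 * h) * wt2 y + wt3 y))); last first.
  by move=> y _; rewrite fcostE.
by rewrite !LI_linear//; [ring|exact: cont_lin].
Qed.

(** The form for comparing stopping times under one hedge. By the potentials the running cost is
    Qfun h x - TI tau x (Qfun h), and since M = Qfun - gapfun the two terminal [Qfun] terms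
    cancel. *)
Lemma cost_good tau x h : a <= x <= b -> good tau x ->
  cost x h tau = (Qfun h x - TI tau x (gapfun h))%:E.
Proof.
move=> axb gt; have [mt st le_tau] := gt.
rewrite cost_quadratic//; congr EFin.
have [cG1 _ _ H1] := pot1; have [cG2 _ _ H2] := pot2; have [cG3 _ _ H3] := pot3.
rewrite H1// H2// H3//.
rewrite (@TI_ext _ _ _ _ _ _ _ _ _ ab _ _ M (fun y => (-1) * gapfun h y + Qfun h y)); last first.
  by move=> y ayb; rewrite (Mfun_Q h)//; ring.
rewrite TI_linear//; [|exact: cont_gapfun|exact: cont_Qfun].
have -> : TI tau x (Qfun h) =
    h ^+ 2 * TI tau x G1 + (- (2 * h) * TI tau x G2 + TI tau x G3).
  by rewrite /Qfun !TI_linear//; exact: cont_lin.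
by rewrite /Qfun; ring.
Qed.

(** * Bounds on the value function by harmonic majorants *)

Lemma good_Tadm tau y : good tau y -> Tadm P W r sig a b y tau.
Proof. by move=> [_ st le_tau]; split => //; apply: aeW => w; exact: le_tau. Qed.

Lemma Vfun_le tau y h : a <= y <= b -> good tau y ->
  (V y h <= (Qfun h y - TI tau y (gapfun h))%:E)%E.
Proof.
move=> ayb gt; rewrite -cost_good//; apply: ereal_inf_lbound.
by exists tau => //; exact: good_Tadm.
Qed.

(** A majorant whose discounted stopped expectation is always phi(y) caps the gain of every good
    time; an arbitrary admissible time is first regularised, which leaves its cost unchanged. *)
Lemma Vfun_ge (phi : R -> R) y h : a <= y <= b -> cont_ab phi ->
  (forall tau, good tau y -> TI tau y phi = phi y) ->
  (forall z, a <= z <= b -> gapfun h z <= phi z) ->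
  ((Qfun h y - phi y)%:E <= V y h)%E.
Proof.
move=> ayb cphi hphi gphi; apply: le_ereal_inf_tmp => _ [tau adm <-].
have [tau' [N [gt mN PN eqN]]] := Tadm_good BM adm.
have -> : cost y h tau = cost y h tau'.
  apply: (integral_eq_off_null mN PN) => w Nw.
  by rewrite /run_int /terminal eqN.
have [mt st _] := gt.
rewrite cost_good// lee_fin lerD2l lerN2 -(hphi _ gt).
by apply: TI_le => //; exact: cont_gapfun.
Qed.

(** The line touching [gapfun h] divided by y^k1, in the scale y^(k2 - k1), becomes a harmonic
    majorant after multiplication by y^k1. *)
Lemma touching h x : a < x < b -> exists phi l u,
  [/\ cont_ab phi,
      forall y tau, a <= y <= b -> good tau y -> TI tau y phi = phi y,
      forall y, a <= y <= b -> gapfun h y <= phi y,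
      phi x = 0 -> forall y, a <= y <= b -> phi y = 0 &
      [/\ a <= l <= x, x <= u <= b, gapfun h l = phi l & gapfun h u = phi u]].
Proof.
move=> axb; have /andP[ax xb] := axb.
have [k1 [k2 [k12 l1 l2]]] := lam_roots r0 sig0.
pose F (y : R) := y `^ (k2 - k1).
pose G y := gapfun h y * y `^ (- k1).
have cF : cont_ab F by exact: within_continuous_powR.
have cG : cont_ab G.
  by move=> y; apply: cvgM; [exact: cont_gapfun|exact: within_continuous_powR].
have iF y z : a <= y -> y < z -> z <= b -> F y < F z.
  by move=> ay yz _; exact: (scale_incr a0 k12).
have [c [s [l [u [lx xu Gle Gl Gu]]]]] := touching_line axb iF cF cG.
have pos y : a <= y -> 0 < y by exact: lt_le_trans.
have p0 y : a <= y -> 0 < y `^ k1 by move=> ay; rewrite powR_gt0// pos.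
have gapG y : a <= y -> gapfun h y = y `^ k1 * G y.
  move=> ay; rewrite /G powRN mulrCA mulfV ?mulr1//.
  by rewrite gt_eqF// p0.
pose phi := harm k1 k2 (c - s * F x) s.
have phiE y : a <= y -> phi y = y `^ k1 * (c + s * (F y - F x)).
  by move=> ay; rewrite /phi /harm (powR_k2 k1 k2 (pos y ay)) -/(F y); ring.
have gphi y : a <= y <= b -> gapfun h y <= phi y.
  move=> ayb; have /andP[ay _] := ayb.
  by rewrite gapG// phiE// ler_pM2l ?p0// Gle.
exists phi, l, u; split => //.
- by apply: cont_harm.
- by move=> y tau ayb gt; apply: (TI_harm BM).
(* A nonnegative affine function that vanishes at the interior point [x] has slope both >= 0 (seen
   at [b]) and <= 0 (seen at [a]), so it is 0. *)
- rewrite phiE ?(ltW ax)// subrr mulr0 addr0 => /eqP.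
  rewrite mulf_eq0 gt_eqF ?p0 ?(ltW ax)//= => /eqP c0.
  have ha : 0 <= phi a by rewrite (le_trans _ (gphi a _)) ?gapfun_ge0 ?lexx ?(ltW ab).
  have hb : 0 <= phi b by rewrite (le_trans _ (gphi b _)) ?gapfun_ge0 ?lexx ?(ltW ab).
  rewrite phiE// c0 add0r pmulr_rge0 ?p0// in ha.
  rewrite phiE ?(ltW ab)// c0 add0r pmulr_rge0 ?p0 ?(ltW ab)// in hb.
  have Fa : F a - F x < 0 by rewrite subr_lt0 iF// ltW.
  have Fb : 0 < F b - F x by rewrite subr_gt0 iF// ltW.
  rewrite pmulr_lge0// in hb; rewrite nmulr_lge0// in ha.
  have s0 : s = 0 by apply/eqP; rewrite eq_le ha hb.
  by move=> y /andP[ay _]; rewrite phiE// c0 s0 mul0r addr0 mulr0.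
- have /andP[al _] := lx; have /andP[xu' _] := xu.
  split => //; first by rewrite gapG// phiE// Gl.
  by rewrite gapG ?phiE ?Gu// (le_trans (ltW ax)).
Qed.

(** Otherwise G2 = h G1 on [a, b], and the average of P' along the path up to any good time would
    equal [h]. A strictly increasing P' contradicts this on one half of [a, b]. *)
Lemma gapfun_nonzero h : exists2 y, a <= y <= b & gapfun h y != 0.
Proof.
apply: contrapT => /forall2NP g0; have [c1 c2 c3] := cont_wt.
have Geq y : a <= y <= b -> G2 y = h * G1 y.
  move=> ayb; have [cG1 Ga1 Gb1 _] := pot1; have [cG2 Ga2 Gb2 _] := pot2.
  have [/G_ratio[g1 _ _]|nayb] := boolP (a < y < b).
    have [//|/negP] := g0 y; rewrite negbK /gapfun mulf_eq0 invr_eq0 (gt_eqF g1) orbF.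
    by rewrite sqrf_eq0 subr_eq0 => /eqP.
  case/andP: ayb nayb => ay yb; rewrite negb_and -!leNgt => /orP[h1|h1].
    have -> : y = a by apply/eqP; rewrite eq_le h1.
    by rewrite Ga1 Ga2 mulr0.
  have -> : y = b by apply/eqP; rewrite eq_le yb.
  by rewrite Gb1 Gb2 mulr0.
have LIeq y tau : a <= y <= b -> good tau y -> LI tau y wt2 = h * LI tau y wt1.
  move=> ayb gt; have [_ _ _ H1] := pot1; have [_ _ _ H2] := pot2.
  rewrite H1// H2//.
  have -> : TI tau y G2 = h * TI tau y G1.
    rewrite -TI_scale//; last by case: pot1.
    exact: TI_ext.
  by rewrite Geq//; ring.
have mid (p q : R) : p < q -> exists2 z, p < z & z < q.
  by move=> pq; exists ((p + q) / 2); have [] := midf_lt pq.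
have [m am mb] := mid _ _ ab.
have inS l u y w t : a <= l -> l <= y <= u -> u <= b -> 0 <= t ->
    (t%:E <= exit l u y w)%E -> l <= Spos W r sig y t w <= u.
  by move=> al lyu ub t0 tt; have := until_exit BM lyu t0 tt; rewrite S_Spos.
have inS' l u y w t : 0 <= t ->
    (t%:E < exit l u y w)%E -> l < Spos W r sig y t w < u.
  by move=> t0 tt; have := before_exit t0 tt; rewrite S_Spos.
(* If h < P'(m), then P' exceeds [h] on all of [m, b]. Otherwise P' <= h on [a, m], possibly with
   equality at [m], so strictness is drawn from the open interval. *)
have [hm|mh] := ltP h (PP m).
  have [y my yb] := mid _ _ mb.
  have ayb : a <= y <= b by rewrite (ltW (lt_trans am my)) ltW.
  have myb : m <= y <= b by rewrite !ltW.
  have gt : good (exit m b y) y by apply: good_exit => //; exact: ltW.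
  have : 0 < LI (exit m b y) y (fun z => - h * wt1 z + wt2 z).
    have E z : - h * wt1 z + wt2 z = (PP z - h) * wt1 z by rewrite /wt1 /wt2; ring.
    have key w t : 0 <= t -> (t%:E <= exit m b y w)%E ->
        0 < - h * wt1 (Spos W r sig y t w) + wt2 (Spos W r sig y t w).
      move=> t0 tt; have /andP[h1 h2] := inS _ _ _ _ _ (ltW am) myb (lexx b) t0 tt.
      rewrite E mulr_gt0//; last by rewrite wt1_gt0// (lt_le_trans a0)// (le_trans (ltW am)).
      by rewrite subr_gt0 (lt_le_trans hm)// PP_le// ltW.
    apply: (LI_gt0 BM r0 ab ayb gt) => //.
    - exact: cont_lin.
    - by move=> w; apply: (@exit_gt0 _ _ _ P) => //; rewrite my.
    - by move=> w t t0 tt; rewrite ltW// key.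
    - by move=> w t t0 /ltW; exact: key.
  have [mt _ _] := gt; rewrite LI_linear// LIeq//; lra.
have [y ay ym] := mid _ _ am.
have ayb : a <= y <= b by rewrite (ltW ay) ltW// (lt_trans ym).
have aym : a <= y <= m by rewrite !ltW.
have gt : good (exit a m y) y by apply: good_exit => //; exact: ltW.
have : 0 < LI (exit a m y) y (fun z => (-1) * wt2 z + h * wt1 z).
  have E z : (-1) * wt2 z + h * wt1 z = (h - PP z) * wt1 z by rewrite /wt1 /wt2; ring.
  apply: (LI_gt0 BM r0 ab ayb gt) => //.
  - by apply: cont_lin => //; exact: cont_scale.
  - by move=> w; apply: (@exit_gt0 _ _ _ P) => //; rewrite ay.
  - move=> w t t0 tt; have /andP[h1 h2] := inS _ _ _ _ _ (lexx a) aym (ltW mb) t0 tt.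
    rewrite E mulr_ge0//; last by rewrite ltW// wt1_gt0// (lt_le_trans a0).
    by rewrite subr_ge0 (le_trans _ mh)// PP_le.
  - move=> w t t0 tt; have /andP[h1 h2] := inS' _ _ _ _ _ t0 tt.
    rewrite E mulr_gt0//; last by rewrite wt1_gt0// (lt_trans a0).
    by rewrite subr_gt0 (lt_le_trans _ mh)// PP_incr// ltW.
have [mt _ _] := gt; rewrite LI_linear//; last exact: cont_scale.
rewrite LI_scale// LIeq//; lra.
Qed.

(** At the hedge G2(x) / G1(x) the gap at [x] is 0, so stopping at once gains nothing. The majorant
    is positive at [x], since otherwise the gap would vanish identically, and the exit from its
    contact interval gains phi(x). *)
Lemma exists_good_hedge x : a < x < b ->
  exists2 h, PP a <= h <= PP b & (V x h < (M x)%:E)%E.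
Proof.
move=> axb; have axb' : a <= x <= b by case/andP: axb => /ltW -> /ltW ->.
have [g1 g2 g3] := G_ratio axb.
exists (G2 x / G1 x).
  by rewrite ler_pdivlMr// ler_pdivrMr// !ltW.
set h := G2 x / G1 x.
have [phi [l [u [cphi hphi gphi phi0 [lx xu gl gu]]]]] := touching h axb.
have gx : gapfun h x = 0.
  by rewrite /gapfun /h divfK ?gt_eqF// subrr expr0n/= mul0r.
have phi_gt0 : 0 < phi x.
  rewrite lt_neqAle; apply/andP; split; last by rewrite -gx gphi.
  apply/eqP => /esym e; have [y ayb /eqP[]] := gapfun_nonzero h.
  by apply/eqP; rewrite eq_le gapfun_ge0// andbT -(phi0 e y ayb) gphi.
have al : a <= l by case/andP: lx.
have ub : u <= b by case/andP: xu.
have gt : good (exit l u x) x by exact: good_exit.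
apply: le_lt_trans (Vfun_le h axb' gt) _.
rewrite (Mfun_Q h)// gx subr0 lte_fin.
rewrite (@TI_exit_ext _ _ _ P _ _ _ _ _ BM _ _ _ (gapfun h) phi)//; last first.
  by case/andP: lx => _ ->; case/andP: xu.
by rewrite hphi// ltrBlDr ltrDl.
Qed.

(** The exit from the non-contact component around [x] is shown to be both optimal for [hs] and
    equal to [taustar]; the fixed-point equation is then the vertex equation of the cost parabola at
    that time. *)
Lemma minimiser_fixed_point x hs : a < x < b -> PP a <= hs <= PP b ->
  (forall h, PP a <= h <= PP b -> (V x hs <= V x h)%E) ->
  [/\ PP a < hs < PP b, Cset P W r sig K a b hs x &
      hs = Gammahat P W r sig K a b hs x].
Proof.
move=> axb Hhs minhs; have axb' : a <= x <= b by case/andP: axb => /ltW -> /ltW ->.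
have [c1 c2 c3] := cont_wt.
have VM : (V x hs < (M x)%:E)%E.
  have [h Hh Vh] := exists_good_hedge axb.
  exact: le_lt_trans (minhs h Hh) Vh.
have [phi [l [u [cphi hphi gphi _ [lx xu gl gu]]]]] := touching hs axb.
have Vge y : a <= y <= b -> ((Qfun hs y - phi y)%:E <= V y hs)%E.
  by move=> ayb; apply: Vfun_ge => // tau; exact: hphi.
have al : a <= l by case/andP: lx.
have ub : u <= b by case/andP: xu.
have gx : gapfun hs x < phi x.
  have := le_lt_trans (Vge x axb') VM.
  by rewrite (Mfun_Q hs)// lte_fin ltrD2l ltrN2.
have lx' : l < x.
  rewrite lt_neqAle; case/andP: lx => _ ->; rewrite andbT.
  by apply/eqP => e; move: gx; rewrite -e gl ltxx.
have xu' : x < u.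
  rewrite lt_neqAle; case/andP: xu => -> _; rewrite andbT.
  by apply/eqP => e; move: gx; rewrite e gu ltxx.
pose q y := phi (clip a b y) - gapfun hs (clip a b y).
have cq : continuous q.
  move=> y; apply: cvgB; first exact: (continuous_comp_clip ab cphi).
  exact: (@continuous_comp_clip R a b ab (gapfun hs) (@cont_gapfun hs) y).
have qE y : a <= y <= b -> q y = phi y - gapfun hs y.
  by move=> ayb; rewrite /q clip_id.
have lb : l <= b by rewrite (le_trans (ltW lx'))//; case/andP: axb'.
have au : a <= u by rewrite (le_trans _ (ltW xu'))//; case/andP: axb'.
(* The contact points [l] and [u] may enclose further ones, which also belong to the stopping set,
   so the component of non-contact around [x] is isolated. *)
have [||||l' [u' [ll' lx'' xu'' uu' [ql' qu' qpos]]]] := positive_component lx' xu' cq.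
- by move=> y _; rewrite subr_ge0 gphi// clip_in.
- by rewrite qE ?al// gl subrr.
- by rewrite qE ?au// gu subrr.
- by rewrite qE// subr_gt0.
have al' : a <= l' by exact: le_trans ll'.
have ub' : u' <= b by exact: le_trans ub.
have alb' : a <= l' <= b by rewrite al' (le_trans (ltW lx''))//; case/andP: axb'.
have aub' : a <= u' <= b by rewrite ub' (le_trans _ (ltW xu''))//; case/andP: axb'.
have gl' : gapfun hs l' = phi l' by move/eqP: ql'; rewrite qE// subr_eq0 => /eqP.
have gu' : gapfun hs u' = phi u' by move/eqP: qu'; rewrite qE// subr_eq0 => /eqP.
(* The interval (z, z) is empty, so its exit time is 0: immediate stopping, phrased as an exit so
   that [TI_exit_ext] applies. *)
have touch_D z : a <= z <= b -> gapfun hs z = phi z -> Dset P W r sig K a b hs z.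
  move=> azb gz; split => //; apply/eqP; rewrite eq_le; apply/andP; split.
    have /andP[az zb] := azb.
    have gt : good (exit z z z) z by exact: good_exit.
    apply: le_trans (Vfun_le hs azb gt) _.
    rewrite (@TI_exit_ext _ _ _ P _ _ _ _ _ BM _ _ _ (gapfun hs) phi) ?lexx//.
    by rewrite hphi// (Mfun_Q hs)// gz.
  by apply: le_trans (Vge z azb); rewrite (Mfun_Q hs)// gz.
have exitV y : l' <= y <= u' -> (V y hs <= (Qfun hs y - phi y)%:E)%E.
  move=> ly; have /andP[h1 h2] := ly.
  have ayb : a <= y <= b by rewrite (le_trans al' h1) (le_trans h2).
  have gt : good (exit l' u' y) y by exact: good_exit.
  apply: le_trans (Vfun_le hs ayb gt) _.
  by rewrite (@TI_exit_ext _ _ _ P _ _ _ _ _ BM _ _ _ (gapfun hs) phi)// hphi.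
have not_D y : l' < y < u' -> ~ Dset P W r sig K a b hs y.
  move=> ly [ayb VMy]; have /andP[h1 h2] := ly.
  have := exitV y; rewrite (ltW h1) (ltW h2) => /(_ isT); rewrite VMy (Mfun_Q hs)// lee_fin.
  by rewrite lerD2l lerN2 leNgt -subr_gt0 -qE// qpos.
have lxu' : l' <= x <= u' by rewrite !ltW.
(* Both ends of the component are stopping points and no point inside is, so the two infima agree on
   every path. *)
have tauE : taustar P W r sig K a b x hs = exit l' u' x.
  apply/funext => w; apply/eqP; rewrite eq_le; apply/andP; split.
    case E: (exit l' u' x w) => [t| |]; [|exact: leey|].
    - have t0 : 0 <= t by rewrite -lee_fin -E exit_ge0.
      apply: ereal_inf_lbound; exists t => //; split => //.
      by have [->|->] := exit_boundary BM lxu' E; apply: touch_D.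
    - by have := exit_ge0 W r sig l' u' x w; rewrite E.
  apply: ereal_inf_le_tmp => _ [t [t0 Dt] <-]; exists t => //; split => //.
  by move=> /not_D.
have gt : good (exit l' u' x) x by exact: good_exit.
have [A0 AB BA] : [/\ 0 < LI (exit l' u' x) x wt1,
    PP a * LI (exit l' u' x) x wt1 < LI (exit l' u' x) x wt2 &
    LI (exit l' u' x) x wt2 < PP b * LI (exit l' u' x) x wt1].
  by apply: LI_ratio => // w; apply: (@exit_gt0 _ _ _ P) => //; rewrite lx''.
have GamE : Gammahat P W r sig K a b hs x =
    LI (exit l' u' x) x wt2 / LI (exit l' u' x) x wt1.
  rewrite /Gammahat /ghat1 /ghat2 tauE.
  by rewrite (Expect_run_int BM r0 ab axb' gt c1) (Expect_run_int BM r0 ab axb' gt c2).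
set A := LI (exit l' u' x) x wt1 in A0 AB BA GamE.
set B := LI (exit l' u' x) x wt2 in AB BA GamE.
have inH : PP a < B / A < PP b by rewrite ltr_pdivlMr// ltr_pdivrMr// AB BA.
(* With [tau] the exit time from (l', u'), the chain is cost(hs, tau) <= V(hs) <= V(B / A) <= cost(B
   / A, tau). The difference of the outer costs is A (hs - B / A)^2, hence it is 0. *)
have hsE : hs = B / A.
  have h1H : PP a <= B / A <= PP b by case/andP: inH => /ltW -> /ltW ->.
  have c_hs : (cost x hs (exit l' u' x) <= V x hs)%E.
    rewrite cost_good// (@TI_exit_ext _ _ _ P _ _ _ _ _ BM _ _ _ (gapfun hs) phi)//.
    by rewrite hphi//; exact: Vge.
  have c_h1 : (V x (B / A) <= cost x (B / A) (exit l' u' x))%E.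
    by rewrite cost_good//; exact: Vfun_le.
  have := le_trans c_hs (le_trans (minhs _ h1H) c_h1).
  rewrite !cost_quadratic// -/A -/B lee_fin => h.
  have : A * (hs - B / A) ^+ 2 <= 0.
    have -> : A * (hs - B / A) ^+ 2 = hs ^+ 2 * A - 2 * hs * B + B ^+ 2 / A.
      by field; exact: lt0r_neq0.
    have e : (B / A) ^+ 2 * A - 2 * (B / A) * B = - (B ^+ 2 / A).
      by field; exact: lt0r_neq0.
    lra.
  rewrite pmulr_rle0// => h2; have := sqr_ge0 (hs - B / A) => h3.
  have /eqP : (hs - B / A) ^+ 2 = 0 by apply/eqP; rewrite eq_le h2.
  by rewrite sqrf_eq0 subr_eq0 => /eqP.
split; [by rewrite hsE|by split|by rewrite GamE].
Qed.

End stopping_problem.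

(** Membership in [Cset] places [x] where the quotient [Gammahat] is meaningful; at a stopping point
    its denominator is 0 and division would return a default value. *)
Theorem mainTheorem16 (R : realType) (d : measure_display) (T : measurableType d)
  (P : probability T R) (W : R -> T -> R) (r sig K a b : R) :
  0 < r -> 0 < sig -> 0 < K -> ahat r sig K <= a -> a < b ->
  is_std_BM P W ->
  AssumptionZ P W r sig K a b ->
  forall x : R, a < x < b ->
  forall hs : R, Pp r sig K a <= hs <= Pp r sig K b ->
  (forall h : R, Pp r sig K a <= h <= Pp r sig K b ->
     (Vfun P W r sig K a b x hs <= Vfun P W r sig K a b x h)%E) ->
  [/\ Pp r sig K a < hs < Pp r sig K b,
      Cset P W r sig K a b hs x
    & hs = Gammahat P W r sig K a b hs x].
Proof.
move=> r0 sig0 K0 Ka ab BM _ x axb hs Hhs minhs.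
have [G1 [G2 [G3 [p1 p2 p3]]]] := potentials_exist r0 sig0 K0 Ka ab BM.
exact: (minimiser_fixed_point r0 sig0 K0 Ka ab BM p1 p2 p3 axb Hhs minhs).
Qed.
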